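(* Let $h>0$, $H=\sqrt2\,h$, let $\nu_1,\nu_2\ge0$ be integers, and let $L_h$ be the standard five-point negative Laplacian on the infinite grid $\mathcal G_h=\{h\,\mathbf j:\mathbf j\in\mathbb Z^2\}$. Let $M_h^H=S_h^{\nu_2}K_h^HS_h^{\nu_1}$ be the iteration operator (acting on errors) of the two-level $V[\nu_1,\nu_2]$ multigrid cycle with the red-black smoother $S_h$ with $\omega=1$, red-black coarsening, transfer operators $I_h^H$, $I_H^h$ defined in the context, Galerkin coarse-level operator $L_H=I_h^HL_hI_H^h$, and coarse-level correction $K_h^H=I_h-I_H^hL_H^{-1}I_h^HL_h$ ($I_h$ the identity). For $\boldsymbol\theta=(\theta_1,\theta_2)$ put $\xi_{\boldsymbol\theta}=\frac12\big(\sin^2\frac{\theta_1}2+\sin^2\frac{\theta_2}2\big)$ and $$\Theta_{rb}^{\mathrm{low}}=\{\boldsymbol\theta\in[-\pi,\pi)^2:\ (\theta_1-\theta_2,\ \theta_1+\theta_2)\in[-\pi,\pi)^2\}.$$ Then for each $\boldsymbol\theta\in\Theta_{rb}^{\mathrm{low}}$, $\boldsymbol\theta\ne\mathbf 0$, the operator $M_h^H$ leaves invariant the two-dimensional space $\mathbb E_{\boldsymbol\theta}=\mathrm{span}\{\phi_h(\cdot,\boldsymbol\theta),\phi_h(\cdot,\bar{\boldsymbol\theta})\}$ and its matrix in this ordered basis is $$\mathbf M(\boldsymbol\theta)=\mathbf S(\boldsymbol\theta)^{\nu_2}\,\mathbf K(\boldsymbol\theta)\,\mathbf S(\boldsymbol\theta)^{\nu_1},$$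 where, with $\mathbf I$ the $2\times2$ identity and $\mathbf D=\mathrm{diag}(\xi_{\boldsymbol\theta},1-\xi_{\boldsymbol\theta})$, $$\mathbf S(\boldsymbol\theta)=\mathbf S^B(\boldsymbol\theta)\mathbf S^R(\boldsymbol\theta),\quad \mathbf S^R=\mathbf I-\begin{bmatrix}1&-1\\-1&1\end{bmatrix}\mathbf D,\quad \mathbf S^B=\mathbf I-\begin{bmatrix}1&1\\1&1\end{bmatrix}\mathbf D,$$ $$\mathbf K(\boldsymbol\theta)=\mathbf I-\hat L_H(\boldsymbol\theta)^{-1}\,\mathbf I_H^h(\boldsymbol\theta)\,\mathbf I_h^H(\boldsymbol\theta)\,\mathbf L(\boldsymbol\theta),$$ $$\mathbf I_h^H(\boldsymbol\theta)=\begin{bmatrix}1-\xi_{\boldsymbol\theta}&\xi_{\boldsymbol\theta}\end{bmatrix},\quad \mathbf I_H^h(\boldsymbol\theta)=\mathbf I_h^H(\boldsymbol\theta)^T,\quad \mathbf L(\boldsymbol\theta)=\tfrac8{h^2}\mathbf D,\quad \hat L_H(\boldsymbol\theta)=\mathbf I_h^H(\boldsymbol\theta)\mathbf L(\boldsymbol\theta)\mathbf I_H^h(\boldsymbol\theta)=\tfrac{8}{h^2}\xi_{\boldsymbol\theta}(1-\xi_{\boldsymbol\theta}).$$ Consequently the asymptotic convergence rate of the two-level cycle is $$\rho=\rho(M_h^H)=\sup_{\boldsymbol\theta\in\Theta_{rb}^{\mathrm{low}},\ \boldsymbol\theta\neq\mathbf 0}\rho\big(\mathbf M(\boldsymbol\theta)\big),$$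 where $\rho(\cdot)$ denotes the spectral radius.
   Context: Write $\mathbf j=(j_1,j_2)$, $e_1=(1,0)$, $e_2=(0,1)$, and $u(\mathbf j)$ for the value of a complex grid function at $h\,\mathbf j$. $(L_hu)(\mathbf j)=h^{-2}\big(4u(\mathbf j)-u(\mathbf j+e_1)-u(\mathbf j-e_1)-u(\mathbf j+e_2)-u(\mathbf j-e_2)\big)$. Red points: $j_1+j_2$ odd; black points: $j_1+j_2$ even. Red-black coarsening: the coarse grid $\mathcal G_H$ is the set of black points. Red-black smoothing operator (on errors) with parameter $\omega$: $S_h=S_h^BS_h^R$, where $S_h^Ru$ equals $u-\frac{\omega h^2}{4}L_hu$ at red points and $u$ at black points, and $S_h^Bu$ equals $u-\frac{\omega h^2}{4}L_hu$ at black points and $u$ at red points. Here $\omega=1$. Restriction: $(I_h^Hd)(\mathbf j)=\frac18\big(4d(\mathbf j)+d(\mathbf j+e_1)+d(\mathbf j-e_1)+d(\mathbf j+e_2)+d(\mathbf j-e_2)\big)$ at black points. Interpolation: $(I_H^hv)(\mathbf j)=v(\mathbf j)$ at black points, and the average of $v$ over the four nearest (black) neighbours at red points. Fourier modes: $\phi_h(\mathbf x,\boldsymbol\theta)=e^{i\boldsymbol\theta\cdot\mathbf x/h}$, $\mathbf x\in\mathcal G_h$, $\boldsymbol\theta\in[-\pi,\pi)^2$. For a scalar $\theta\in[-\pi,\pi)$, $\bar\theta\in[-\pi,\pi)$ denotes $\theta+\pi$ reduced modulo $2\pi$; $\bar{\boldsymbol\theta}=(\bar\theta_1,\bar\theta_2)$.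 The matrix of an operator $A$ on $\mathbb E_{\boldsymbol\theta}$ is the matrix $\mathbf A$ with $A[\phi_h(\cdot,\boldsymbol\theta)\ \ \phi_h(\cdot,\bar{\boldsymbol\theta})]=[\phi_h(\cdot,\boldsymbol\theta)\ \ \phi_h(\cdot,\bar{\boldsymbol\theta})]\,\mathbf A$. $L_H^{-1}$ is understood mode by mode: for $\boldsymbol\theta\in\Theta_{rb}^{\mathrm{low}}\setminus\{\mathbf 0\}$ the restriction $\phi$ of $\phi_h(\cdot,\boldsymbol\theta)$ to the black points is an eigenfunction of $L_H$ with nonzero eigenvalue $\hat L_H(\boldsymbol\theta)$, and $L_H^{-1}\phi=\hat L_H(\boldsymbol\theta)^{-1}\phi$. Accordingly $M_h^H$ is regarded as the operator on square-summable grid functions $\ell^2(\mathcal G_h)$ defined through the Fourier decomposition $u(\mathbf x)=\int_{[-\pi,\pi)^2}\hat u(\boldsymbol\theta)\phi_h(\mathbf x,\boldsymbol\theta)\,d\boldsymbol\theta$ (the single frequency $\boldsymbol\theta=\mathbf 0$, and its alias, being a null set). *)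

(* Defs.v *)
From HB Require Import structures.
From mathcomp Require Import all_boot all_order all_algebra complex.
From mathcomp Require Import all_classical all_reals all_analysis measurable_realfun.

Set Implicit Arguments.
Unset Strict Implicit.
Unset Printing Implicit Defensive.
Import Order.TTheory GRing.Theory Num.Theory.
Import ComplexField.Normc.
Local Open Scope classical_set_scope.
Local Open Scope ring_scope.
Local Open Scope complex_scope.

Definition black (j : int * int) : bool := (2 %| j.1 + j.2)%Z.

Definition east (j : int * int) : int * int := (j.1 + 1, j.2).
Definition west (j : int * int) : int * int := (j.1 - 1, j.2).
Definition north (j : int * int) : int * int := (j.1, j.2 + 1).
Definition south (j : int * int) : int * int := (j.1, j.2 - 1).

Section GridOperators.
Context {R : realType}.

(* [u j] is the value of the grid function [u] at the point [h j].            *)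
Definition fine := int * int -> R[i].

Definition black_point := {j : int * int | black j}.
Definition coarse := black_point -> R[i].

Definition nbsum (u : fine) (j : int * int) : R[i] :=
  u (east j) + u (west j) + u (north j) + u (south j).

Definition Lh (h : R) (u : fine) : fine :=
  fun j => (h ^- 2)%:C * (4 * u j - nbsum u j).

Definition relax (h omega : R) (u : fine) : fine :=
  fun j => u j - (omega * h ^+ 2 / 4)%:C * Lh h u j.

Definition smooth_red (h omega : R) (u : fine) : fine :=
  fun j => if black j then u j else relax h omega u j.

Definition smooth_black (h omega : R) (u : fine) : fine :=
  fun j => if black j then relax h omega u j else u j.

Definition smooth (h omega : R) (u : fine) : fine :=
  smooth_black h omega (smooth_red h omega u).

Definition restr_full (d : fine) : coarse :=
  fun b => 8^-1 * (4 * d (val b) + nbsum d (val b)).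

Definition ext0 (v : coarse) : fine :=
  fun j => oapp v 0 (insub j : option black_point).

(* All four neighbours of a red point are black, so the zero extension only   *)
(* serves to make [v] total.                                                  *)
Definition interp (v : coarse) : fine :=
  fun j => if black j then ext0 v j else nbsum (ext0 v) j / 4.

Definition LH (h : R) (v : coarse) : coarse := restr_full (Lh h (interp v)).

Definition inject (u : fine) : coarse := fun b => u (val b).

Definition expi (t : R) : R[i] := cos t +i* sin t.

Definition grid_point (h : R) (j : int * int) : R * R :=
  (h * j.1%:~R, h * j.2%:~R).

Definition mode (h : R) (theta : R * R) : fine := fun j =>
  let x := grid_point h j in
  expi ((theta.1 * x.1 + theta.2 * x.2) / h).

Definition box : set (R * R) :=
  [set theta | (- pi <= theta.1 < pi) && (- pi <= theta.2 < pi)].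

Definition low : set (R * R) :=
  [set theta | box theta /\ box (theta.1 - theta.2, theta.1 + theta.2)].

Definition low_nz : set (R * R) := [set theta | low theta /\ theta <> (0, 0)].

(* [t + pi] reduced modulo [2 pi], for [t] in [-pi, pi).                      *)
Definition bar1 (t : R) : R := if t < 0 then t + pi else t - pi.
Definition bar (theta : R * R) : R * R := (bar1 theta.1, bar1 theta.2).

(* The inverse of [LH], mode by mode: on the span of the modes with           *)
(* frequencies in [low_nz], each mode is divided by its eigenvalue.  These    *)
(* modes are linearly independent on the black points, so the result is       *)
(* unique; coarse functions outside the span are sent to the junk value 0.    *)
Definition LHinv_spec (h : R) (v w : coarse) : Prop :=
  exists (n : nat) (theta : 'I_n -> R * R) (c l : 'I_n -> R[i]),
  [/\ forall k, low_nz (theta k),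
      forall k, l k != 0,
      forall k b, LH h (inject (mode h (theta k))) b
                  = l k * inject (mode h (theta k)) b,
      forall b, v b = \sum_(k < n) c k * inject (mode h (theta k)) b &
      forall b, w b = \sum_(k < n) c k * (l k)^-1
                                   * inject (mode h (theta k)) b].

Definition LHinv (h : R) (v : coarse) : coarse :=
  xget (fun=> 0) [set w | LHinv_spec h v w].

Definition Kop (h : R) (u : fine) : fine :=
  fun j => u j - interp (LHinv h (restr_full (Lh h u))) j.

(* The iteration operator on (finite combinations of) Fourier modes.          *)
Definition Mop (h : R) (nu1 nu2 : nat) (u : fine) : fine :=
  iter nu2 (smooth h 1) (Kop h (iter nu1 (smooth h 1) u)).

Definition comb (h : R) (theta : R * R) (c : 'cV[R[i]]_2) : fine :=
  fun j => mode h theta j * c 0 0 + mode h (bar theta) j * c 1 0.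

Definition E (h : R) (theta : R * R) : set fine := range (comb h theta).

Definition has_matrix (h : R) (theta : R * R) (A : fine -> fine)
    (B : 'M[R[i]]_2) : Prop :=
  forall c : 'cV[R[i]]_2, A (comb h theta c) = comb h theta (B *m c).

Definition mx22 (a b c d : R[i]) : 'M[R[i]]_2 :=
  \matrix_(i < 2, j < 2)
    if i == 0 then (if j == 0 then a else b) else (if j == 0 then c else d).

Definition xi (theta : R * R) : R :=
  (sin (theta.1 / 2) ^+ 2 + sin (theta.2 / 2) ^+ 2) / 2.

Definition Dmx (theta : R * R) : 'M[R[i]]_2 :=
  mx22 (xi theta)%:C 0 0 (1 - xi theta)%:C.

Definition SRmx (theta : R * R) : 'M[R[i]]_2 :=
  1%:M - mx22 1 (-1) (-1) 1 *m Dmx theta.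

Definition SBmx (theta : R * R) : 'M[R[i]]_2 :=
  1%:M - mx22 1 1 1 1 *m Dmx theta.

Definition Smx (theta : R * R) : 'M[R[i]]_2 := SBmx theta *m SRmx theta.

Definition restr_mx (theta : R * R) : 'rV[R[i]]_2 :=
  \row_(j < 2) if j == 0 then (1 - xi theta)%:C else (xi theta)%:C.

Definition interp_mx (theta : R * R) : 'cV[R[i]]_2 := (restr_mx theta)^T.

Definition Lmx (h : R) (theta : R * R) : 'M[R[i]]_2 :=
  (8 / h ^+ 2)%:C *: Dmx theta.

Definition LHhat (h : R) (theta : R * R) : R[i] :=
  (restr_mx theta *m Lmx h theta *m interp_mx theta) 0 0.

Definition Kmx (h : R) (theta : R * R) : 'M[R[i]]_2 :=
  1%:M - (LHhat h theta)^-1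
           *: (interp_mx theta *m restr_mx theta *m Lmx h theta).

Definition Mmx (h : R) (nu1 nu2 : nat) (theta : R * R) : 'M[R[i]]_2 :=
  Smx theta ^+ nu2 *m Kmx h theta *m Smx theta ^+ nu1.

Definition l2sq (u : fine) : \bar R :=
  \esum_(j in [set: int * int]) (normc (u j) ^+ 2)%:E.

Definition l2 : set fine := [set u | (l2sq u < +oo)%E].

Definition bounded_l2 (T : fine -> fine) : Prop :=
  (forall (a : R[i]) (u v : fine), l2 u -> l2 v ->
     T (fun j => a * u j + v j) = fun j => a * T u j + T v j) /\
  (exists C : R, forall u, l2 u -> (l2sq (T u) <= C%:E * l2sq u)%E).

Definition resolvent (T : fine -> fine) : set R[i] := [set z |
  exists B : fine -> fine, bounded_l2 B /\
    forall u, l2 u -> B (fun j => T u j - z * u j) = u /\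
                      (fun j => T (B u) j - z * B u j) = u].

Definition spectrum (T : fine -> fine) : set R[i] := ~` resolvent T.

(* Both radii live in the extended reals, so that no junk value of a          *)
(* real supremum can intervene.                                               *)
Definition spectral_radius_op (T : fine -> fine) : \bar R :=
  ereal_sup [set (normc z)%:E | z in spectrum T].

Definition spectral_radius_mx (n : nat) (A : 'M[R[i]]_n) : \bar R :=
  ereal_sup [set (normc z)%:E | z in [set z | eigenvalue A z]].

Definition leb2 : {measure set (measurableTypeR R * measurableTypeR R) -> \bar R} :=
  ((@lebesgue_measure R) \x (@lebesgue_measure R))%E.

Definition integral_box (f : R * R -> R[i]) : R[i] :=
  Rintegral leb2 box (fun theta => complex.Re (f theta))
  +i* Rintegral leb2 box (fun theta => complex.Im (f theta)).

Definition L2_box : set (R * R -> R[i]) := [set f : R * R -> R[i] |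
  [/\ measurable_fun box (fun theta => complex.Re (f theta) : R),
      measurable_fun box (fun theta => complex.Im (f theta) : R) &
      (\int[leb2]_(theta in box) (normc (f theta) ^+ 2)%:E < +oo)%E]].

Definition fourier_repr (h : R) (u : fine) (f : R * R -> R[i]) : Prop :=
  L2_box f /\ forall j, u j = integral_box (fun theta => f theta * mode h theta j).

(* The Fourier transform of [u] in [l2], unique up to a null set.             *)
Definition fourier (h : R) (u : fine) : R * R -> R[i] :=
  xget (fun=> 0) [set f | fourier_repr h u f].

(* The iteration operator on [l2]: apply [Mop] under the Fourier integral.    *)
Definition Mop_l2 (h : R) (nu1 nu2 : nat) (u : fine) : fine :=
  fun j => integral_box
    (fun theta => fourier h u theta * Mop h nu1 nu2 (mode h theta) j).

End GridOperators.

(* Main.v *)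
Require Import Defs.
From HB Require Import structures.
From mathcomp Require Import all_boot all_order all_algebra complex.
From mathcomp Require Import all_classical all_reals all_analysis.
From mathcomp Require Import measurable_realfun ring lra zify.

Set Implicit Arguments.
Unset Strict Implicit.
Unset Printing Implicit Defensive.
Import Order.TTheory GRing.Theory Num.Theory.
Import numFieldNormedType.Exports.
Import ComplexField.Normc.
Local Open Scope classical_set_scope.
Local Open Scope ring_scope.
Local Open Scope complex_scope.

(* With omega = 1 one red relaxation replaces each red value by the average of its
   black neighbours, and the coarse-level correction K is, on every space E_theta,
   the local operator which vanishes at black points and subtracts from each red
   value the average of its neighbours.  Hence K is a projection and S K = 0, so
   M^2 = 0 as soon as nu1 + nu2 > 0, while M = K when nu1 = nu2 = 0.  The same
   identities hold for the matrices M(theta), by linear independence of the two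
   modes.  Both spectral radii follow from T^2 = eps T with eps in {0, 1}.

   The operator on l2 is defined through Fourier integrals; it equals the local
   operator because every u in l2 is such an integral (Riesz-Fischer, obtained from
   an L1-fast subsequence of the partial sums) and because the symbol of M agrees
   with that of the local operator outside the null set {0, (-pi, -pi)}. *)

(** * Limits of fast Cauchy sequences *)

(** Let A be the average over the four neighbours, which exchanges the two colours. At black points
    the restriction of L_h u is (2/h^2)(u - A^2 u), which involves black values only, and L_H is the
    same Schur complement (2/h^2)(I - A^2). So the coarse-level equation returns the black values of
    u exactly, and interpolation subtracts A u at red points: this is [Kloc]. The cancellation
    cannot be carried out on l2 at once, since the symbol of L_H tends to 0 at the origin and L_H
    has no bounded inverse there; it is made mode by mode and moved under the Fourier integral. At
    the two exceptional frequencies the restricted residual vanishes, so K acts as the identity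
    while [Kloc] does not; hence the detour through a null set. Any square-integrable density
    representing u will do, because the local operator commutes with integration whichever one
    [fourier] selects. *)

Section FastLimit.
Context d (T : measurableType d) (R : realType).
Variables (mu : {measure set T -> \bar R}) (D : set T).
Hypothesis mD : measurable D.

(** Only what a Fourier coefficient sees is kept of the limit: integrals against test functions
    bounded by 1 pass to it by dominated convergence, and a uniform bound on second moments passes
    to it by Fatou. *)
Lemma fast_L1_limit (g : nat -> T -> R) :
  (forall n, mu.-integrable D (EFin \o g n)) ->
  (\sum_(0 <= n <oo) \int[mu]_(x in D) (`|g n.+1 x - g n x|)%:E < +oo)%E ->
  exists f : T -> R, [/\ measurable_fun D f,
    (forall phi : T -> R, measurable_fun D phi ->
       (forall x, D x -> `|phi x| <= 1) ->
       (\int[mu]_(x in D) (g n x * phi x))%R @[n --> \oo]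
         --> (\int[mu]_(x in D) (f x * phi x))%R) &
    (forall C : \bar R, (forall n, \int[mu]_(x in D) (g n x ^+ 2)%:E <= C)%E ->
       (\int[mu]_(x in D) (f x ^+ 2)%:E <= C)%E)].
Proof.
move=> ig sg.
have mg n : measurable_fun D (g n) by apply/measurable_EFinP; apply: measurable_int (ig n).
pose a n x := `|g n.+1 x - g n x|.
have ma n : measurable_fun D (EFin \o a n).
  apply/measurable_EFinP; apply: measurableT_comp => //.
  exact: measurable_funB.
have m0 : measurable_fun D (fun x => (`|g 0%N x|)%:E).
  by apply/measurable_EFinP; apply: measurableT_comp.
(* By telescoping, [S] dominates every [g n]; its integral is finite by [sg] and monotone
   convergence. *)
pose S x : \bar R := ((`|g 0%N x|)%:E + \sum_(0 <= n <oo) (a n x)%:E)%E.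
have a0 n x : (0 <= (a n x)%:E)%E by rewrite lee_fin normr_ge0.
have S0 x : (0 <= S x)%E by rewrite adde_ge0 ?lee_fin// nneseries_ge0.
have mS' : measurable_fun D (fun x => \sum_(0 <= n <oo) (a n x)%:E)%E.
  apply: (@ge0_emeasurable_sum _ _ _ _ (fun n x => (a n x)%:E) xpredT) => [k x _ _|k _].
    exact: a0.
  exact: ma.
have mS : measurable_fun D S by exact: emeasurable_funD m0 mS'.
have iS : mu.-integrable D S.
  apply/integrableP; split => //.
  under eq_integral do rewrite gee0_abs//.
  rewrite ge0_integralD//; last by move=> x _; rewrite nneseries_ge0.
  apply: lte_add_pinfty.
    by have /integrableP[_] := ig 0%N.
  by rewrite integral_nneseries.
have gS n x : (`|(g n x)%:E| <= S x)%E.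
  have : (`|(g n x)%:E| <= (`|g 0%N x|)%:E + \sum_(0 <= k < n) (a k x)%:E)%E.
    elim: n => [|n IH]; first by rewrite big_geq// adde0.
    rewrite big_nat_recr//= addeA.
    apply: (@le_trans _ _ (`|(g n x)%:E| + (a n x)%:E)%E); last exact: leeD2r.
    rewrite -EFinD lee_fin.
    have -> : g n.+1 x = g n x + (g n.+1 x - g n x) by ring.
    exact: ler_normD.
  move/le_trans; apply; apply: leeD2l.
  by apply: nneseries_lim_ge => k _ _; exact: a0.
(* [S] may be infinite on a null set. Cutting off there makes the sequence converge at every point,
   so the pointwise limit [f] is measurable and [lim] never takes a default value. *)
pose A := D `&` [set x | S x \is a fin_num].
have mA : measurable A by exact: emeasurable_fin_num.
pose h n x := g n x * \1_A x.
have mh n : measurable_fun D (h n).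
  by apply: measurable_funM => //; apply: measurable_funTS.
have cvh x : cvgn (h ^~ x).
  have [Ax|nAx] := pselect (A x); last first.
    rewrite (_ : h ^~ x = cst 0); first exact: is_cvg_cst.
    by apply/funext => n; rewrite /h indicE memNset// mulr0.
  rewrite (_ : h ^~ x = g ^~ x); last first.
    by apply/funext => n; rewrite /h indicE mem_set// mulr1.
  have -> : g ^~ x = cst (g 0%N x) + series (telescope (g ^~ x)).
    by apply/funext => n; rewrite /cst /= telescopeK/= fctE /= addrC subrK.
  apply: is_cvgD; first exact: is_cvg_cst.
  apply: normed_cvg.
  have fS : (\sum_(0 <= n <oo) (a n x)%:E < +oo)%E.
    case: Ax => _ /=; rewrite /S fin_numD => /andP[_].
    by rewrite ge0_fin_numE// nneseries_ge0.
  apply: nondecreasing_is_cvgn.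
    by apply: nondecreasing_series => n _ _; exact: normr_ge0.
  exists (fine (\sum_(0 <= n <oo) (a n x)%:E)%E) => _ [n _ <-].
  rewrite -lee_fin fineK ?ge0_fin_numE ?nneseries_ge0//.
  rewrite /series/= -sumEFin.
  by apply: nneseries_lim_ge => k _ _; exact: a0.
pose f x := lim (h ^~ x @ \oo).
have hf x : h ^~ x @ \oo --> f x by exact: cvh.
have mf : measurable_fun D f.
  by apply: (measurable_fun_cvg mh) => x _; exact: hf.
have aeA : \forall x \ae mu, D x -> A x.
  have := integrable_ae mD iS.
  by apply: filterS => x /[swap] Dx /(_ Dx).
exists f; split => //.
- move=> phi mphi bphi.
  have mgp n : measurable_fun D (fun x => g n x * phi x) by exact: measurable_funM.
  have mfp : measurable_fun D (fun x => f x * phi x) by exact: measurable_funM.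
  have [] := @dominated_convergence _ _ _ mu _ mD
    (fun n x => (g n x * phi x)%:E) (fun x => (f x * phi x)%:E) S _ _ _ iS _.
  + by move=> n; apply/measurable_EFinP.
  + exact/measurable_EFinP.
  + move: aeA; apply: filterS => x DA Dx.
    have Ax := DA Dx.
    apply: cvg_EFin; first exact: nearW.
    have gx : g ^~ x @ \oo --> f x.
      have := hf x; rewrite (_ : h ^~ x = g ^~ x)//.
      by apply/funext => n; rewrite /h indicE mem_set// mulr1.
    exact: (cvgM gx (cvg_cst (phi x))).
  + apply: aeW => x n Dx; apply: le_trans (gS n x).
    rewrite !abse_EFin lee_fin normrM ler_piMr//; exact: bphi.
  move=> if_ _ cv.
  apply: fine_cvg; rewrite fineK//.
  exact: integrable_fin_num.
- move=> C gC.
  have f2 x : ((f x ^+ 2)%:E = limn_einf (fun n => (h n x ^+ 2)%:E))%E.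
    apply/esym/(cvg_limn_einf_sup _).1.
    apply: cvg_EFin; first exact: nearW.
    rewrite expr2 (_ : _ \o _ = (fun n => h n x * h n x)); last first.
      by apply/funext => n /=; rewrite expr2.
    exact: (cvgM (hf x) (hf x)).
  under eq_integral do rewrite f2.
  have mh2 n : measurable_fun D (fun x => (h n x ^+ 2)%:E).
    by apply/measurable_EFinP; exact: measurable_funX.
  have h20 n x : D x -> (0 <= (h n x ^+ 2)%:E)%E by rewrite lee_fin sqr_ge0.
  apply: (le_trans (fatou mu mD mh2 h20)).
  have -> : C = limn_einf (fun=> C).
    by apply/esym/(cvg_limn_einf_sup _).1; exact: cvg_cst.
  rewrite !limn_einf_lim; apply: lee_lim; [exact: is_cvg_einfs|exact: is_cvg_einfs|].
  apply: nearW => n; rewrite /einfs /=; apply: le_ereal_inf_tmp => _ [m /= nm <-].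
  apply: (@le_trans _ _ (\int[mu]_(x in D) (h m x ^+ 2)%:E)%E).
    by apply: ereal_inf_lbound; exists m.
  apply: le_trans (gC m); apply: ge0_le_integral => //.
  + exact: h20.
  + by apply/measurable_EFinP; exact: measurable_funX.
  + move=> x _; rewrite lee_fin /h indicE; case: (_ \in _); rewrite ?mulr1//.
    by rewrite mulr0 expr0n/= sqr_ge0.
Qed.
End FastLimit.

Section L2Limit.
Context d (T : measurableType d) (R : realType).
Variables (mu : {measure set T -> \bar R}) (D : set T).
Hypotheses (mD : measurable D) (finD : (mu D < +oo)%E).

Lemma L2_integrable (f : T -> R) : measurable_fun D f ->
  (\int[mu]_(x in D) (f x ^+ 2)%:E < +oo)%E -> mu.-integrable D (EFin \o f).
Proof.
move=> mf f2; have m2 : measurable_fun D (fun x => (f x ^+ 2)%:E).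
  by apply/measurable_EFinP; exact: measurable_funX.
apply: (@le_integrable _ _ _ mu D mD _ (fun x => 1%:E + (f x ^+ 2)%:E)%E).
- exact/measurable_EFinP.
- move=> x Dx; rewrite -EFinD !abse_EFin lee_fin [leRHS]ger0_norm; last first.
    by rewrite addr_ge0// sqr_ge0.
  rewrite ler_norml; nra.
- apply: integrableD => //.
    apply/integrableP; split; first exact: measurable_cst.
    by under eq_integral do rewrite abse_EFin normr1; rewrite integral_cst// mul1e.
  apply/integrableP; split => //.
  by under eq_integral do rewrite abse_EFin ger0_norm ?sqr_ge0//.
Qed.

(** The bounds are on squared norms, so consecutive terms lie at L2 distance at most 2^-n; on a set
    of finite measure this makes the L1 distances summable, as [fast_L1_limit] asks. *)
Lemma L2_fast_limit (g : nat -> T -> R) (C : R) :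
  (forall n, measurable_fun D (g n)) ->
  (forall n, \int[mu]_(x in D) (g n x ^+ 2)%:E <= C%:E)%E ->
  (forall n, \int[mu]_(x in D) ((g n.+1 x - g n x) ^+ 2)%:E <= (4^-1 ^+ n)%:E)%E ->
  exists f : T -> R, [/\ measurable_fun D f,
    (\int[mu]_(x in D) (f x ^+ 2)%:E < +oo)%E &
    (forall phi : T -> R, measurable_fun D phi ->
       (forall x, D x -> `|phi x| <= 1) ->
       (\int[mu]_(x in D) (g n x * phi x))%R @[n --> \oo]
         --> (\int[mu]_(x in D) (f x * phi x))%R)].
Proof.
move=> mg gC dg.
have ig n : mu.-integrable D (EFin \o g n).
  by apply: L2_integrable => //; apply: le_lt_trans (gC n) _; exact: ltry.
have [|f [mf fphi fC]] := @fast_L1_limit _ _ _ mu D mD g ig; last first.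
  exists f; split => //.
  by apply: le_lt_trans (fC C%:E gC) _; exact: ltry.
have fM : (mu D) \is a fin_num by rewrite ge0_fin_numE.
pose M := fine (mu D).
have M0 : 0 <= M by exact: fine_ge0.
(* [epsilon_trick0] sums eps / 2^(i+1) to at most eps; the factor 2 makes the general term (M + 1) /
   2^i. *)
apply: (@le_lt_trans _ _
    (\sum_(0 <= i <oo) ((2 * (M + 1)) / (2 ^ i.+1)%:R)%:E)%E); last first.
  apply: le_lt_trans (epsilon_trick0 xpredT _) _; last exact: ltry.
  by rewrite mulr_ge0// addr_ge0.
apply: lee_nneseries => [n _ _|n _].
  by apply: integral_ge0 => x _; rewrite lee_fin normr_ge0.
have mdg : measurable_fun D (fun x => g n.+1 x - g n x) by exact: measurable_funB.
have mdg2 : measurable_fun D (fun x => ((g n.+1 x - g n x) ^+ 2)%:E).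
  by apply/measurable_EFinP; exact: measurable_funX.
have p2 : 0 < 2 ^+ n :> R by rewrite exprn_gt0.
(* Weighted inequality |y| <= 2^-n + 2^n y^2: after integration the two terms contribute at most
   2^-n M and 2^n 4^-n = 2^-n. *)
apply: (@le_trans _ _ (\int[mu]_(x in D) ((2 ^- n)%:E
    + (2 ^+ n)%:E * ((g n.+1 x - g n x) ^+ 2)%:E))%E).
  apply: ge0_le_integral => //.
  - by apply/measurable_EFinP; exact: measurableT_comp.
  - by apply: emeasurable_funD => //; exact: measurable_funeM.
  - move=> x _; rewrite -EFinM -EFinD lee_fin.
    set y := g n.+1 x - g n x.
    rewrite -(real_normK (num_real y)); set z := `|y|.
    have : 0 <= (2 ^+ n * z - 1) ^+ 2 by rewrite sqr_ge0.
    have z0 : 0 <= z by rewrite normr_ge0.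
    rewrite -(ler_pM2l p2) mulrDr divff ?gt_eqF//; nra.
rewrite ge0_integralD//; last 2 first.
- by move=> x _; rewrite -EFinM lee_fin mulr_ge0 ?sqr_ge0 ?ltW.
- exact: measurable_funeM.
rewrite ge0_integralZl//; last by move=> x _; rewrite lee_fin sqr_ge0.
rewrite integral_cst// -/(mu D) -(fineK fM) -/M.
apply: (@le_trans _ _ ((2 ^- n)%:E * M%:E + (2 ^+ n)%:E * (4^-1 ^+ n)%:E)%E).
  by rewrite leeD2l// lee_wpmul2l ?lee_fin ?(ltW p2).
rewrite -!EFinM -EFinD lee_fin le_eqVlt; apply/orP; left; apply/eqP.
rewrite natrX exprS.
have -> : 4^-1 ^+ n = (2 ^+ n)^-1 * (2 ^+ n)^-1 :> R.
  by rewrite -!exprVn -exprMn; congr (_ ^+ _); field.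
by field; rewrite gt_eqF.
Qed.
End L2Limit.

(** * Fourier integrals on the box *)

Section Characters.
Variable R : realType.
Implicit Types (m : int) (j k : int * int) (t : R * R).

Lemma nat_int2_bij : exists q : nat -> int * int, bijective q.
Proof.
have /card_set_bijP[p] : ([set: int * int] #= [set: nat])%card.
  apply: Cantor_Bernstein; first exact: countableP.
  apply/infiniteP => /(finite_image (fun j : int * int => absz j.1)).
  suff -> : [set absz j.1 | j in [set: int * int]] = [set: nat] by exact: infinite_nat.
  by apply/seteqP; split => // n _; exists (n%:Z, 0).
by rewrite setTT_bijective => -[q pq qp]; exists q; exists p.
Qed.

Lemma sinDint (x : R) m : sin (x + m%:~R * (pi *+ 2)) = sin x.
Proof.
case: m => n; first by rewrite -pmulrn mulr_natl (periodicn (@sinD2pi R)).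
rewrite NegzE mulrNz mulNr -pmulrn mulr_natl.
by rewrite -[in RHS](subrK (pi *+ 2 *+ n.+1) x) (periodicn (@sinD2pi R)).
Qed.

(** The phase [c] does double duty: it absorbs the other variable in an iterated integral, and a
    shift by - pi / 2 turns the cosine into the sine of the imaginary part. *)
Lemma integral_cos_itv m (c : R) : m != 0 ->
  (\int[lebesgue_measure]_(y in `[(- pi)%R, pi[) (cos (m%:~R * y + c))%:E = 0 :> \bar R)%E.
Proof.
move=> m0; have mR0 : m%:~R != 0 :> R by rewrite intr_eq0.
rewrite integral_itv_bndo_bndc; last first.
  apply/measurable_EFinP; apply: measurable_funTS.
  apply: continuous_measurable_fun => x.
  apply: continuous_comp; last exact: continuous_cos.
  by apply: cvgD; [apply: cvgM; [exact: cvg_cst|exact: cvg_id]|exact: cvg_cst].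
pose F y : R := m%:~R^-1 * sin (m%:~R * y + c).
have dF (y : R) : is_derive y 1 F (cos (m%:~R * y + c)).
  rewrite /F; apply: is_derive_eq.
  by rewrite /GRing.scale/= addr0 mulr1 mulrC mulfK.
have cF : continuous F.
  by move=> z; apply/differentiable_continuous/derivable1_diffP; exact: ex_derive.
rewrite (@continuous_FTC2 _ _ F)//=.
- rewrite /F (_ : m%:~R * pi + c = m%:~R * - pi + c + m%:~R * (pi *+ 2)).
    by rewrite sinDint -EFinB subrr.
  by ring.
- by rewrite -subr_gt0 opprK addr_gt0 ?pi_gt0.
- apply: continuous_subspaceT => x.
  apply: continuous_comp; last exact: continuous_cos.
  by apply: cvgD; [apply: cvgM; [exact: cvg_cst|exact: cvg_id]|exact: cvg_cst].
- split; first by move=> y _; exact: ex_derive.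
  + by apply: cvg_at_right_filter; exact: cF.
  + by apply: cvg_at_left_filter; exact: cF.
- move=> y _; rewrite derive1E; exact: derive_val.
Qed.

(** Fubini in either order. For a nonzero frequency only one component is known to be nonzero, and
    the inner integral must run over the corresponding variable; hence the disjunction. *)
Lemma integral_setX_eq0 d1 d2 (T1 : measurableType d1) (T2 : measurableType d2)
    (m1 : {sigma_finite_measure set T1 -> \bar R})
    (m2 : {sigma_finite_measure set T2 -> \bar R})
    (A : set T1) (B : set T2) (f : T1 * T2 -> \bar R) :
  measurable A -> measurable B -> (m1 \x m2)%E.-integrable (A `*` B) f ->
  (forall x, A x -> \int[m2]_(y in B) f (x, y) = 0)%E \/
  (forall y, B y -> \int[m1]_(x in A) f (x, y) = 0)%E ->
  (\int[m1 \x m2]_(z in A `*` B) f z = 0)%E.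
Proof.
move=> mA mB /integrable_mkcond-/(_ (measurableX mA mB)) fi f0.
rewrite integral_mkcond; case: f0 => f0.
- rewrite -integral12_prod_meas1//; apply: integral0_eq => x _.
  rewrite /fubini_F; have [Ax|nAx] := pselect (A x).
    rewrite -[RHS](f0 x Ax) [RHS]integral_mkcond; apply: eq_integral => y _.
    rewrite !patchE; congr (if _ then _ else _).
    by apply/idP/idP; rewrite !inE => // -[].
  apply: integral0_eq => y _; rewrite patchE memNset// => -[].
  by move=> /nAx.
- rewrite -integral21_prod_meas1//; apply: integral0_eq => y _.
  rewrite /fubini_G; have [By|nBy] := pselect (B y).
    rewrite -[RHS](f0 y By) [RHS]integral_mkcond; apply: eq_integral => x _.
    rewrite !patchE; congr (if _ then _ else _).
    by apply/idP/idP; rewrite !inE => // -[].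
  apply: integral0_eq => x _; rewrite patchE memNset// => -[_].
  by move=> /nBy.
Qed.

Lemma box_setX : @box R = `[(- pi)%R, pi[ `*` `[(- pi)%R, pi[.
Proof.
apply/seteqP; split => t; rewrite /box/= !in_itv/=.
  by move/andP.
by move=> [-> ->].
Qed.

Lemma measurable_box :
  measurable (box : set (measurableTypeR R * measurableTypeR R)).
Proof. by rewrite box_setX; exact: measurableX. Qed.

Lemma leb2_box : leb2 (@box R) = ((pi *+ 2) ^+ 2)%:E.
Proof.
rewrite box_setX [LHS](@product_measure1E _ _ _ _ _ lebesgue_measure lebesgue_measure)//=.
rewrite lebesgue_measure_itv/= lte_fin -subr_gt0 opprK addr_gt0 ?pi_gt0//.
Qed.

Lemma measurable_cos_lin (D : set (measurableTypeR R * measurableTypeR R)) (a b c : R) :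
  measurable_fun D (fun t => cos (a * t.1 + b * t.2 + c)).
Proof.
apply: measurable_funTS.
apply: (measurableT_comp (f := @cos R)).
  by apply: continuous_measurable_fun; exact: continuous_cos.
apply: measurable_funD => //.
apply: measurable_funD.
- apply: measurable_funM => //; exact: measurable_fst.
- apply: measurable_funM => //; exact: measurable_snd.
Qed.

Lemma integral_box_cos j (c : R) : j != (0, 0) ->
  (\int[leb2]_(t in box) (cos (j.1%:~R * t.1 + j.2%:~R * t.2 + c))%:E = 0)%E.
Proof.
move=> j0.
have ic : leb2.-integrable box
    (fun t => (cos (j.1%:~R * t.1 + j.2%:~R * t.2 + c))%:E).
  apply: measurable_bounded_integrable.
  - exact: measurable_box.
  - by rewrite leb2_box ltry.
  - exact: measurable_cos_lin.
  - exists 1; split => // x x1 t _; apply: le_trans (ltW x1).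
    by rewrite ler_norml cos_geN1 cos_le1.
move: ic; rewrite box_setX => ic.
apply: integral_setX_eq0 => //=.
have [j2|j2] := eqVneq j.2 0.
- right => y _; rewrite -[RHS](@integral_cos_itv j.1 (j.2%:~R * y + c)).
    by under [RHS]eq_integral do rewrite addrA.
  by apply: contra j0 => /eqP j1; rewrite [j]surjective_pairing j1 j2.
- left => x _; rewrite -[RHS](@integral_cos_itv j.2 (j.1%:~R * x + c))//.
  by under [LHS]eq_integral do rewrite -addrA addrCA.
Qed.
End Characters.

(** * Complex integrals over the box and orthogonality of characters *)

Section ComplexIntegral.
Variable R : realType.
Implicit Types (f g : R * R -> R[i]) (c : R[i]) (j k : int * int) (t : R * R).

Lemma sqr_normcE (z : R[i]) : normc z ^+ 2 = complex.Re z ^+ 2 + complex.Im z ^+ 2.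
Proof. by case: z => a b /=; rewrite sqr_sqrtr// addr_ge0// sqr_ge0. Qed.

Definition integrableC f : Prop :=
  leb2.-integrable (@box R) (fun t => (complex.Re (f t))%:E) /\
  leb2.-integrable (@box R) (fun t => (complex.Im (f t))%:E).

Lemma integrableCD f g : integrableC f -> integrableC g ->
  integrableC (fun t => f t + g t).
Proof.
move=> [f1 f2] [g1 g2]; have mb := @measurable_box R; split.
- have := (integrableD mb f1 g1); apply: eq_integrable => // t _ /=.
  by case: (f t) (g t) => a b [a' b'].
- have := (integrableD mb f2 g2); apply: eq_integrable => // t _ /=.
  by case: (f t) (g t) => a b [a' b'].
Qed.

Lemma integrableCZ c f : integrableC f -> integrableC (fun t => c * f t).
Proof.
move=> [f1 f2]; have mb := @measurable_box R; case: c => a b; split.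
- have := integrableB mb (integrableZl mb a f1) (integrableZl mb b f2).
  apply: eq_integrable => // t _ /=.
  by case: (f t) => x y.
- have := integrableD mb (integrableZl mb a f2) (integrableZl mb b f1).
  apply: eq_integrable => // t _ /=.
  by case: (f t) => x y.
Qed.

Lemma integrableC0 : integrableC (fun=> 0).
Proof. by split; exact: integrable0. Qed.

Lemma integrableC_sum (I : eqType) (s : seq I) (F : I -> R * R -> R[i]) :
  (forall i, i \in s -> integrableC (F i)) ->
  integrableC (fun t => \sum_(i <- s) F i t).
Proof.
elim: s => [_|i s IH sF].
  by under eq_fun do rewrite big_nil; exact: integrableC0.
under eq_fun do rewrite big_cons.
apply: integrableCD; first by apply: sF; rewrite mem_head.
by apply: IH => l ks; apply: sF; rewrite in_cons ks orbT.
Qed.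

Lemma integral_boxD f g : integrableC f -> integrableC g ->
  integral_box (fun t => f t + g t) = integral_box f + integral_box g.
Proof.
move=> [f1 f2] [g1 g2]; have mb := @measurable_box R.
rewrite /integral_box; apply/eqP; rewrite eq_complex /=; apply/andP; split; apply/eqP.
- by rewrite -RintegralD//; apply: eq_Rintegral => t _; case: (f t) (g t) => a b [].
- by rewrite -RintegralD//; apply: eq_Rintegral => t _; case: (f t) (g t) => a b [].
Qed.

Lemma integral_boxZ c f : integrableC f ->
  integral_box (fun t => c * f t) = c * integral_box f.
Proof.
move=> [f1 f2]; have mb := @measurable_box R; case: c => a b.
rewrite /integral_box; apply/eqP; rewrite eq_complex /=; apply/andP; split; apply/eqP.
- rewrite -!RintegralZl// -RintegralB//; last 2 first.
  + exact: (integrableZl mb a f1).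
  + exact: (integrableZl mb b f2).
  by apply: eq_Rintegral => t _; case: (f t).
- rewrite -!RintegralZl// -RintegralD//; last 2 first.
  + exact: (integrableZl mb a f2).
  + exact: (integrableZl mb b f1).
  by apply: eq_Rintegral => t _; case: (f t).
Qed.

Lemma integral_box0 : integral_box (fun=> 0 : R[i]) = 0.
Proof. by rewrite /integral_box /Rintegral/= integral0. Qed.

Lemma integral_box_sum (I : eqType) (s : seq I) (F : I -> R * R -> R[i]) :
  (forall i, i \in s -> integrableC (F i)) ->
  integral_box (fun t => \sum_(i <- s) F i t) = \sum_(i <- s) integral_box (F i).
Proof.
elim: s => [_|i s IH sF].
  by under eq_fun do rewrite big_nil; rewrite big_nil integral_box0.
under eq_fun do rewrite big_cons.
have sF' l : l \in s -> integrableC (F l) by move=> ks; apply: sF; rewrite in_cons ks orbT.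
rewrite big_cons integral_boxD ?IH//; first by apply: sF; rewrite mem_head.
exact: integrableC_sum.
Qed.

Definition char j t : R[i] := expi (j.1%:~R * t.1 + j.2%:~R * t.2).

Lemma expiD (a b : R) : expi (a + b) = expi a * expi b.
Proof.
by rewrite /expi cosD sinD; apply/eqP; rewrite eq_complex /= eqxx /= addrC mulrC [X in _ + X]mulrC.
Qed.

Lemma charD j k t : char (j + k) t = char j t * char k t.
Proof. by rewrite /char -expiD /= !intrD; congr expi; ring. Qed.

Lemma char_conj j t : (char j t)^*%C = char (- j) t.
Proof.
rewrite /char /= !intrN !mulNr -opprD /expi cosN sinN.
by apply/eqP; rewrite eq_complex /= !eqxx.
Qed.

Lemma mode_char (h : R) t j : 0 < h -> mode h t j = char j t.
Proof.
move=> h0; rewrite /mode /char /=; congr expi; field.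
by rewrite gt_eqF.
Qed.

Lemma measurable_Re_char (D : set (measurableTypeR R * measurableTypeR R)) j :
  measurable_fun D (fun t => complex.Re (char j t)).
Proof.
rewrite [X in measurable_fun _ X](_ : _ =
  fun t => cos (j.1%:~R * t.1 + j.2%:~R * t.2 + 0)); first exact: measurable_cos_lin.
by apply/funext => t; rewrite addr0.
Qed.

Lemma Im_char j t : complex.Im (char j t) = cos (j.1%:~R * t.1 + j.2%:~R * t.2 + - (pi / 2)).
Proof. by rewrite -sinDpihalf subrK. Qed.

Lemma measurable_Im_char (D : set (measurableTypeR R * measurableTypeR R)) j :
  measurable_fun D (fun t => complex.Im (char j t)).
Proof. by under eq_fun do rewrite Im_char; exact: measurable_cos_lin. Qed.

Lemma Re_char_le1 j t : `|complex.Re (char j t)| <= 1.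
Proof. by rewrite ler_norml cos_geN1 cos_le1. Qed.

Lemma Im_char_le1 j t : `|complex.Im (char j t)| <= 1.
Proof. by rewrite ler_norml sin_geN1 sin_le1. Qed.

Lemma bounded_box (g : R * R -> R) :
  (forall t, `|g t| <= 1) -> [bounded g t | t in (@box R)].
Proof. by move=> g1; exists 1; split => // x x1 t _; apply: le_trans (ltW x1). Qed.

Lemma integrableC_char j : integrableC (char j).
Proof.
split.
- apply: measurable_bounded_integrable; first exact: measurable_box.
  + by rewrite leb2_box ltry.
  + exact: measurable_Re_char.
  + by apply: bounded_box => t; exact: Re_char_le1.
- apply: measurable_bounded_integrable; first exact: measurable_box.
  + by rewrite leb2_box ltry.
  + exact: measurable_Im_char.
  + by apply: bounded_box => t; exact: Im_char_le1.
Qed.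

Lemma integral_box_char j :
  integral_box (char j) = if j == 0 then ((pi *+ 2) ^+ 2)%:C else 0.
Proof.
have [->|j0] := eqVneq j 0.
  have -> : char 0 = fun=> 1.
    by apply/funext => t; rewrite /char !mul0r addr0 /expi cos0 sin0.
  rewrite /integral_box /= /Rintegral/= [in X in _ +i* X]integral0; congr (_ +i* _).
  by rewrite integral_cst ?mul1e ?leb2_box//; exact: measurable_box.
rewrite /integral_box /Rintegral; apply/eqP; rewrite eq_complex; apply/andP; split; apply/eqP.
- rewrite -[RHS]/(fine 0) -(integral_box_cos 0 j0) /=.
  by under [in RHS]eq_integral do rewrite addr0.
- rewrite -[RHS]/(fine 0) -(integral_box_cos (- (pi / 2)) j0) [LHS]/=.
  by congr fine; apply: eq_integral => t _; rewrite -Im_char.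
Qed.
End ComplexIntegral.

(** * Parseval for finite sums, and square-integrable densities *)

Section Fourier.
Variable R : realType.
Implicit Types (f : R * R -> R[i]) (j k : int * int) (t : R * R).
Local Notation K := ((pi *+ 2) ^+ 2 : R).

Lemma mul_conjcE (z : R[i]) : z * z^*%C = (normc z ^+ 2)%:C.
Proof.
by rewrite sqr_normcE; case: z => a b; apply/eqP; rewrite eq_complex /=; apply/andP;
  split; apply/eqP; ring.
Qed.

(** The characters are those of [- q i] because [fourier_repr] recovers the value at j by
    integrating against the character of j itself. The squared modulus expands into a double sum
    whose off-diagonal terms integrate to zero. *)
Lemma parseval (I : eqType) (q : I -> int * int) (a : I -> R[i]) (s : seq I) :
  injective q -> uniq s ->
  (\int[leb2]_(t in box) (normc (\sum_(i <- s) a i * char (- q i) t) ^+ 2)%:E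
   = (K * \sum_(i <- s) normc (a i) ^+ 2)%:E)%E.
Proof.
move=> qi us.
pose F i t := \sum_(l <- s) (a i * (a l)^*%C) * char (q l - q i) t.
have conjM (x y : R[i]) : (x * y)^*%C = x^*%C * y^*%C by exact: rmorphM.
have conj_sum (G : I -> R[i]) : (\sum_(i <- s) G i)^*%C = \sum_(i <- s) (G i)^*%C.
  exact: rmorph_sum.
have FE t : (normc (\sum_(i <- s) a i * char (- q i) t) ^+ 2)%:C = \sum_(i <- s) F i t.
  rewrite -mul_conjcE conj_sum big_distrlr; apply: eq_bigr => i _.
  apply: eq_bigr => l _; rewrite conjM char_conj opprK charD.
  by rewrite -[LHS]/(_ * _ * (_ * _)); ring.
have iF i : integrableC (F i).
  by apply: integrableC_sum => l _; exact/integrableCZ/integrableC_char.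
have iG : integrableC (fun t => \sum_(i <- s) F i t) by exact: integrableC_sum.
have := integral_box_sum (fun i (_ : i \in s) => iF i).
have -> : \sum_(i <- s) integral_box (F i) = (K * \sum_(i <- s) normc (a i) ^+ 2)%:C.
  rewrite rmorphM rmorph_sum /= mulr_sumr; apply: eq_big_seq => i si.
  rewrite integral_box_sum => [|l _]; last exact/integrableCZ/integrableC_char.
  rewrite (bigD1_seq i)//= big1 => [|l li].
    rewrite integral_boxZ; last exact: integrableC_char.
    by rewrite integral_box_char subrr eqxx addr0 mul_conjcE mulrC.
  rewrite integral_boxZ; last exact: integrableC_char.
  by rewrite integral_box_char subr_eq0 (inj_eq qi) (negbTE li) mulr0.
move=> /(congr1 (@complex.Re R)) /= <-.
rewrite /Rintegral fineK; last first.
  by apply: integrable_fin_num; [exact: measurable_box|exact: iG.1].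
by apply: eq_integral => t _; rewrite -FE.
Qed.

Lemma integrableC_mul_char f j : integrableC f -> integrableC (fun t => f t * char j t).
Proof.
move=> [f1 f2]; have mb := @measurable_box R.
have mR := @measurable_Re_char R box j.
have mI := @measurable_Im_char R box j.
have bR := bounded_box (@Re_char_le1 R j); have bI := bounded_box (@Im_char_le1 R j).
split.
- have := integrableB mb (integrableMl mb f1 mR bR) (integrableMl mb f2 mI bI).
  apply: eq_integrable => // t _ /=.
  by case: (f t).
- have := integrableD mb (integrableMl mb f1 mI bI) (integrableMl mb f2 mR bR).
  apply: eq_integrable => // t _ /=.
  by case: (f t).
Qed.

(** The limit theorems concern real functions, so a complex coefficient is split into four real
    integrals, each against a test function bounded by 1. *)
Lemma integral_box_mul_char f j : integrableC f ->
  integral_box (fun t => f t * char j t) =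
    (Rintegral leb2 box (fun t => complex.Re (f t) * complex.Re (char j t))
     - Rintegral leb2 box (fun t => complex.Im (f t) * complex.Im (char j t)))
  +i* (Rintegral leb2 box (fun t => complex.Re (f t) * complex.Im (char j t))
     + Rintegral leb2 box (fun t => complex.Im (f t) * complex.Re (char j t))).
Proof.
move=> [f1 f2]; have mb := @measurable_box R.
have mR := @measurable_Re_char R box j.
have mI := @measurable_Im_char R box j.
have bR := bounded_box (@Re_char_le1 R j); have bI := bounded_box (@Im_char_le1 R j).
rewrite /integral_box; congr (_ +i* _).
- rewrite -RintegralB//; last 2 first.
  + exact: (integrableMl mb f1 mR bR).
  + exact: (integrableMl mb f2 mI bI).
  by apply: eq_Rintegral => t _; case: (f t).
- rewrite -RintegralD//; last 2 first.
  + exact: (integrableMl mb f1 mI bI).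
  + exact: (integrableMl mb f2 mR bR).
  by apply: eq_Rintegral => t _; case: (f t).
Qed.

Lemma L2_box_integrableC f : L2_box f -> integrableC f.
Proof.
move=> [m1 m2 f2].
have m12 : measurable_fun (@box R) (fun t => complex.Re (f t) ^+ 2) by exact: measurable_funX.
have m22 : measurable_fun (@box R) (fun t => complex.Im (f t) ^+ 2) by exact: measurable_funX.
have mn : measurable_fun (@box R) (fun t => normc (f t) ^+ 2).
  by under eq_fun do rewrite sqr_normcE; exact: measurable_funD.
split; apply: (@L2_integrable _ _ _ leb2 _ (@measurable_box R)) => //.
- by rewrite leb2_box ltry.
- apply: le_lt_trans f2; apply: ge0_le_integral; first exact: measurable_box.
  + by move=> t _; rewrite lee_fin sqr_ge0.
  + exact/measurable_EFinP.
  + exact/measurable_EFinP.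
  + by move=> t _; rewrite lee_fin sqr_normcE lerDl sqr_ge0.
- by rewrite leb2_box ltry.
- apply: le_lt_trans f2; apply: ge0_le_integral; first exact: measurable_box.
  + by move=> t _; rewrite lee_fin sqr_ge0.
  + exact/measurable_EFinP.
  + exact/measurable_EFinP.
  + by move=> t _; rewrite lee_fin sqr_normcE lerDr sqr_ge0.
Qed.
End Fourier.

(** * Existence of a Fourier density for every square-summable grid function *)

Section RieszFischer.
Variable R : realType.
Local Notation K := ((pi *+ 2) ^+ 2 : R).

(** With coefficients u / K, Parseval gives a density of mass 1 / K times that of u; K >= 1 bounds
    it by the mass of u itself, so no constant appears in the estimates. *)
Lemma pi2_sqr_ge1 : 1 <= K.
Proof. by rewrite mulr2n; have := pi_ge2 R; nra. Qed.

(* [N] increases so that consecutive partial sums differ by a single block. *)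
Lemma fast_partial_sums (w : nat -> R) : (forall i, 0 <= w i) -> cvgn (series w) ->
  exists N : nat -> nat, [/\ forall n, (N n <= N n.+1)%N, forall n, (n <= N n)%N &
    forall n, \sum_(N n <= i < N n.+1) w i <= 4^-1 ^+ n].
Proof.
move=> w0 cw; set L := lim (series w @ \oo).
have wL n : series w n <= L.
  by apply: nondecreasing_cvgn_le => //; apply: nondecreasing_series.
have /choice[M hM] : forall n, exists M, forall m, (M <= m)%N -> L - 4^-1 ^+ n <= series w m.
  move=> n; have e0 : 0 < 4^-1 ^+ n :> R by rewrite exprn_gt0.
  have /cvgrPdist_le/(_ _ e0)[M _ hM] := cw.
  exists M => m Mm; have := hM m Mm; rewrite ler_norml => /andP[_]; rewrite -/L; lra.
(* Summing the thresholds makes [N] monotone while staying above each [M n]; the summand n makes it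
   unbounded, so that every index is eventually included. *)
pose N n := (\sum_(k < n.+1) M k + n)%N.
have NS n : (N n <= N n.+1)%N.
  by rewrite /N [leqRHS]addnS [in leqRHS]big_ord_recr /= leqW// leq_add2r leq_addr.
exists N; split => // [n|n]; first exact: leq_addl.
have MN : (M n <= N n)%N by rewrite /N big_ord_recr /= -addnA addnCA leq_addr.
have := hM n _ MN; have := wL (N n.+1); rewrite /series /= (big_cat_nat (n := N n))//=.
by lra.
Qed.

(** The coefficient at j of a partial sum is exactly [u j] once the index of j has been reached.
    Convergence against characters then gives the coefficient of the limit as the limit of an
    eventually constant sequence. *)
Lemma fourier_exists (h : R) (u : Defs.fine) : 0 < h -> l2 u ->
  exists f, fourier_repr h u f.
Proof.
move=> h0 u2; have [q qbij] := nat_int2_bij.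
have qi : injective q by exact: bij_inj.
have K1 := pi2_sqr_ge1; have K0 : 0 < K by lra.
pose w i := normc (u (q i)) ^+ 2.
have w0 i : 0 <= w i by rewrite sqr_ge0.
have wS : (\sum_(0 <= i <oo) (w i)%:E < +oo)%E.
  rewrite nneseries_esumT; last by move=> i; rewrite lee_fin.
  have := u2; rewrite /l2 /l2sq /= (reindex_esum [set: nat] _ q)//.
  by rewrite setTT_bijective.
pose S := fine (\sum_(0 <= i <oo) (w i)%:E)%E.
have wleS n : \sum_(0 <= i < n) w i <= S.
  have S0 : (0 <= \sum_(0 <= i <oo) (w i)%:E)%E.
    by apply: nneseries_ge0 => i _ _; rewrite lee_fin.
  rewrite -lee_fin /S fineK ?ge0_fin_numE//.
  by rewrite -sumEFin; apply: nneseries_lim_ge => k _ _; rewrite lee_fin.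
have cw : cvgn (series w).
  apply: nondecreasing_is_cvgn; first by apply: nondecreasing_series.
  by exists S => _ [m _ <-]; exact: wleS.
have [N [NS nN Nw]] := fast_partial_sums w0 cw.
(* [integral_box] carries no normalising factor, so the coefficients are divided by the area K of
   the box. *)
pose c i : R[i] := K^-1%:C * u (q i).
have cw2 i : normc (c i) ^+ 2 = K^-1 ^+ 2 * w i.
  by rewrite normcM exprMn /w; congr (_ * _); rewrite sqr_normcE /= expr0n addr0.
have sumc (s : seq nat) : K * \sum_(i <- s) normc (c i) ^+ 2 <= \sum_(i <- s) w i.
  under eq_bigr do rewrite cw2.
  rewrite -mulr_sumr mulrA ler_piMl ?sumr_ge0//.
  by rewrite expr2 mulrA divff ?gt_eqF// mul1r invf_le1.
pose F n t := \sum_(0 <= i < N n) c i * char (- q i) t.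
have FS n t : F n.+1 t - F n t = \sum_(N n <= i < N n.+1) c i * char (- q i) t.
  by rewrite /F (big_cat_nat (n := N n))//= addrAC subrr add0r.
have iblock m n : integrableC (fun t => \sum_(m <= i < n) c i * char (- q i) t).
  by apply: integrableC_sum => i _; exact/integrableCZ/integrableC_char.
have mF n : measurable_fun (@box R) (fun t => complex.Re (F n t)) /\
            measurable_fun (@box R) (fun t => complex.Im (F n t)).
  by have [/measurable_int/measurable_EFinP i1 /measurable_int/measurable_EFinP i2] :=
    iblock 0%N (N n).
have mn m n : measurable_fun (@box R)
    (fun t => (normc (\sum_(m <= i < n) c i * char (- q i) t) ^+ 2)%:E).
  have [/measurable_int/measurable_EFinP i1 /measurable_int/measurable_EFinP i2] := iblock m n.
  apply/measurable_EFinP; under eq_fun do rewrite sqr_normcE.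
  by apply: measurable_funD; apply: measurable_funX.
have mb := @measurable_box R.
have blockP m n (e : R) : \sum_(m <= i < n) w i <= e ->
   (\int[leb2]_(t in box) (normc (\sum_(m <= i < n) c i * char (- q i) t) ^+ 2)%:E <= e%:E)%E.
  move=> we; rewrite (parseval c qi (iota_uniq _ _)) lee_fin; apply: le_trans we.
  exact: sumc.
have finb : (leb2 (@box R) < +oo)%E by rewrite leb2_box ltry.
(* [P] stands for the real or the imaginary part: compatible with differences, hence with blocks of
   the series, and dominated by the modulus. *)
have limP (P : R[i] -> R) : (forall n, measurable_fun (@box R) (fun t => P (F n t))) ->
    (forall x y, P (x - y) = P x - P y) -> (forall x, P x ^+ 2 <= normc x ^+ 2) ->
    exists f : R * R -> R, [/\ measurable_fun box f,
    (\int[leb2]_(x in box) (f x ^+ 2)%:E < +oo)%E &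
    (forall phi : R * R -> R, measurable_fun box phi ->
       (forall x, box x -> `|phi x| <= 1) ->
       (\int[leb2]_(x in box) (P (F n x) * phi x))%R @[n --> \oo]
         --> (\int[leb2]_(x in box) (f x * phi x))%R)].
  move=> mP PB Pn.
  apply: (@L2_fast_limit _ _ _ leb2 box mb finb (fun n t => P (F n t)) S) => // n.
  - apply: le_trans (blockP _ _ _ (wleS (N n))).
    apply: ge0_le_integral => //.
    + by move=> t _; rewrite lee_fin sqr_ge0.
    + by apply/measurable_EFinP; apply: measurable_funX; exact: mP.
    + exact: mn.
    + by move=> t _; rewrite lee_fin; exact: Pn.
  - apply: le_trans (blockP _ _ _ (Nw n)).
    apply: ge0_le_integral => //.
    + by move=> t _; rewrite lee_fin sqr_ge0.
    + by apply/measurable_EFinP; apply: measurable_funX; apply: measurable_funB; exact: mP.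
    + exact: mn.
    + by move=> t _; rewrite lee_fin -FS -PB; exact: Pn.
have [||x|fr [mfr fr2 frc]] := limP (@complex.Re R).
- by move=> n; have [] := mF n.
- by case=> a b [].
- by rewrite sqr_normcE lerDl sqr_ge0.
have [||x|fi [mfi fi2 fic]] := limP (@complex.Im R).
- by move=> n; have [] := mF n.
- by case=> a b [].
- by rewrite sqr_normcE lerDr sqr_ge0.
pose f t : R[i] := fr t +i* fi t.
have f2 : L2_box f.
  split => //.
  have m1 : measurable_fun (@box R) (fun t => (fr t ^+ 2)%:E).
    by apply/measurable_EFinP; exact: measurable_funX.
  have m2 : measurable_fun (@box R) (fun t => (fi t ^+ 2)%:E).
    by apply/measurable_EFinP; exact: measurable_funX.
  under eq_integral do rewrite sqr_normcE EFinD.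
  rewrite ge0_integralD//; first exact: lte_add_pinfty.
  + by move=> t _; rewrite lee_fin sqr_ge0.
  + by move=> t _; rewrite lee_fin sqr_ge0.
exists f; split => // j.
have -> : (fun t => f t * mode h t j) = (fun t => f t * char j t).
  by apply/funext => t; rewrite mode_char.
have [i0 qi0] : exists i, q i = j by have [p _ qp] := qbij; exists (p j).
have coef n : (i0 < n)%N -> integral_box (fun t => F n t * char j t) = u j.
  move=> i0n; have i0N : (i0 < N n)%N by exact: leq_trans (nN n).
  under eq_fun do rewrite /F mulr_suml.
  under eq_fun do under eq_bigr do rewrite -mulrA -charD.
  rewrite integral_box_sum => [|i _]; last exact/integrableCZ/integrableC_char.
  rewrite (bigD1_seq i0) ?iota_uniq ?mem_index_iota//= big1 => [|i ii0].
    rewrite integral_boxZ; last exact: integrableC_char.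
    rewrite integral_box_char qi0 addNr eqxx addr0 /c qi0 mulrAC -rmorphM /=.
    by rewrite mulVf ?gt_eqF// mul1r.
  rewrite integral_boxZ; last exact: integrableC_char.
  by rewrite integral_box_char addrC subr_eq0 -qi0 (inj_eq qi) eq_sym (negbTE ii0) mulr0.
have mR := @measurable_Re_char R box j.
have mI := @measurable_Im_char R box j.
have lR (x : R * R) : box x -> `|complex.Re (char j x)| <= 1 by move=> _; exact: Re_char_le1.
have lI (x : R * R) : box x -> `|complex.Im (char j x)| <= 1 by move=> _; exact: Im_char_le1.
rewrite integral_box_mul_char; last exact: L2_box_integrableC.
have eqn : \forall n \near \oo, integral_box (fun t => F n t * char j t) = u j.
  by exists i0.+1 => // n /= i0n; exact: coef.
have iF n : integrableC (F n) by exact: iblock.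
rewrite (_ : u j = complex.Re (u j) +i* complex.Im (u j)); last by case: (u j).
congr (_ +i* _).
- have cv := cvgB (frc _ mR lR) (fic _ mI lI).
  rewrite -[RHS](cvg_lim (@Rhausdorff R) (cv _)); apply/esym/cvg_lim; first exact: Rhausdorff.
  apply: cvg_near_cst; move: eqn; apply: filterS => n.
  by rewrite integral_box_mul_char// => <-.
- have cv := cvgD (frc _ mI lI) (fic _ mR lR).
  rewrite -[RHS](cvg_lim (@Rhausdorff R) (cv _)); apply/esym/cvg_lim; first exact: Rhausdorff.
  apply: cvg_near_cst; move: eqn; apply: filterS => n.
  by rewrite integral_box_mul_char// => <-.
Qed.
End RieszFischer.

(** * The cycle as a local operator *)

Section LocalOperators.
Variable R : realType.
Implicit Types (u v : int * int -> R[i]) (j : int * int) (t : R * R) (h : R).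

Lemma black_nb j : [/\ black (east j) = ~~ black j, black (west j) = ~~ black j,
  black (north j) = ~~ black j & black (south j) = ~~ black j].
Proof.
have d1 (m : int) : (2 %| m + 1)%Z = ~~ (2 %| m)%Z by lia.
have d2 (m : int) : (2 %| m - 1)%Z = ~~ (2 %| m)%Z by lia.
rewrite /black /east /west /north /south /=; split.
- by rewrite addrAC d1.
- by rewrite addrAC d2.
- by rewrite addrA d1.
- by rewrite addrA d2.
Qed.

(* [Kop] on the two-dimensional Fourier spaces: there [LHinv] cancels out. *)
Definition Kloc u : int * int -> R[i] :=
  fun j => if black j then 0 else u j - nbsum u j / 4.

Lemma relax1 h u j : 0 < h -> relax h 1 u j = nbsum u j / 4.
Proof.
move=> h0; have hC : h%:C != 0 by rewrite (inj_eq (@complexI R)) gt_eqF.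
rewrite /relax /Lh mul1r !(rmorphM, fmorphV, rmorphXn) /= [4%:C]rmorph_nat.
by field.
Qed.

Lemma smoothE h u j : 0 < h -> smooth h 1 u j =
  if black j then nbsum (smooth_red h 1 u) j / 4 else nbsum u j / 4.
Proof.
move=> h0; rewrite /smooth /smooth_black; case: ifP => bj; first by rewrite relax1.
by rewrite /smooth_red bj relax1.
Qed.

Lemma eq_nbsum u v j : (forall k, black k = ~~ black j -> u k = v k) ->
  nbsum u j = nbsum v j.
Proof.
by move=> uv; have [e w n s] := black_nb j; rewrite /nbsum !uv.
Qed.

(** Functions in the range of [Kloc] vanish at black points, so the red half-step averages zeros and
    leaves the zero function to the black half-step. *)
Lemma smooth_Kloc h u : 0 < h -> smooth h 1 (Kloc u) = fun=> 0.
Proof.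
move=> h0; have z (k : int * int) : nbsum (fun=> 0 : R[i]) k = 0 by rewrite /nbsum !addr0.
have r0 k : smooth_red h 1 (Kloc u) k = 0.
  rewrite /smooth_red; case: ifP => bk; first by rewrite /Kloc bk.
  rewrite relax1// (@eq_nbsum _ (fun=> 0)) ?z ?mul0r// => l.
  by rewrite bk /Kloc => ->.
apply/funext => j; rewrite smoothE//; case: ifP => bj.
  by rewrite (@eq_nbsum _ (fun=> 0)) ?z ?mul0r.
have := r0 j; rewrite /smooth_red bj relax1//.
Qed.

Lemma Kloc_idem u : Kloc (Kloc u) = Kloc u.
Proof.
apply/funext => j; rewrite {1 3}/Kloc; case: ifP => bj//.
rewrite (@eq_nbsum (Kloc u) (fun=> 0)) => [|k]; last by rewrite bj /Kloc => ->.
by rewrite /nbsum !addr0 mul0r subr0 /Kloc bj.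
Qed.

Lemma Kloc0 : Kloc (fun=> 0) = fun=> 0.
Proof. by apply/funext => j; rewrite /Kloc /nbsum !addr0 mul0r subr0 if_same. Qed.

Lemma smooth0 h : 0 < h -> smooth h 1 (fun=> 0) = fun=> 0 :> R[i].
Proof. by move=> h0; rewrite -[in LHS]Kloc0 smooth_Kloc. Qed.

Definition Gloc h nu1 nu2 u := iter nu2 (smooth h 1) (Kloc (iter nu1 (smooth h 1) u)).

(** Between the two occurrences of [Kloc] the post-smoothing of the first cycle meets the
    pre-smoothing of the second: nu1 + nu2 steps, the first of which already gives zero. *)
Lemma Gloc_nilpotent h nu1 nu2 u : 0 < h -> (0 < nu1 + nu2)%N ->
  Gloc h nu1 nu2 (Gloc h nu1 nu2 u) = fun=> 0.
Proof.
move=> h0 nu0; have it0 n : iter n (smooth h 1) (fun=> 0) = fun=> 0.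
  by elim: n => //= n ->; exact: smooth0.
rewrite /Gloc -iterD; case: (nu1 + nu2)%N nu0 => // n _.
by rewrite iterSr smooth_Kloc// it0 Kloc0 it0.
Qed.
End LocalOperators.

(** * Grid operators on modes modulated by colour *)

Section Modes.
Variables (R : realType) (h : R).
Hypothesis h0 : 0 < h.
Implicit Types (u v : int * int -> R[i]) (j : int * int) (t : R * R) (x y : R[i]).

Let hC : h%:C != 0. Proof. by rewrite (inj_eq (@complexI R)) gt_eqF. Qed.

Lemma xi_cos t : 1 - 2 * xi t = (cos t.1 + cos t.2) / 2.
Proof.
have c2 (a : R) : cos a = 1 - 2 * sin (a / 2) ^+ 2.
  rewrite -[in LHS](@divfK _ 2 _ a)// mulr_natr cos_mulr2n -mulr_natr.
  have := cos2Dsin2 (a / 2); lra.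
by rewrite /xi (c2 t.1) (c2 t.2); field.
Qed.

(** Symbol p of the neighbour average, that is (cos t.1 + cos t.2) / 2 by [xi_cos]. *)
Definition pmode t : R[i] := (1 - 2 * xi t)%:C.

Lemma nbsum_mode t j : nbsum (mode h t) j = mode h t j * (4 * pmode t).
Proof.
have E : 4 * pmode t = char (1, 0) t + char (-1, 0) t + char (0, 1) t + char (0, -1) t.
  rewrite /pmode xi_cos /char /expi /= !mul0r !addr0 !add0r !mulN1r !mul1r !cosN !sinN.
  rewrite -[4]/(4%:R) -(rmorph_nat (@real_complex R)) -rmorphM /=.
  by apply/eqP; rewrite eq_complex /=; apply/andP; split; apply/eqP; field.
by rewrite /nbsum !mode_char// E !mulrDr -!charD; congr (char _ _ + char _ _ + char _ _ + char _ _);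
  case: j => j1 j2; rewrite /east /west /north /south /=; congr (_, _); rewrite addr0.
Qed.

Definition sgn j : R[i] := if black j then 1 else -1.

Lemma expi_int_pi (m : int) : expi (m%:~R * pi) = (if (2 %| m)%Z then 1 else -1) :> R[i].
Proof.
have expiDpi (a : R) : expi (a + pi) = - expi a.
  by rewrite /expi sinDpi cosDpi.
have nat_case n : expi (n%:R * pi) = (if (2 %| n%:Z)%Z then 1 else -1) :> R[i].
  elim: n => [|n IH]; first by rewrite mul0r /expi cos0 sin0.
  rewrite mulrSr mulrDl mul1r expiDpi IH.
  have -> : (2 %| n.+1%:Z)%Z = ~~ (2 %| n%:Z)%Z by lia.
  by case: ifP => _ //=; rewrite opprK.
case: m => n; first exact: nat_case.
rewrite NegzE mulrNz mulNr -[LHS]conjcK.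
have cj (a : R) : (expi (- a))^*%C = expi a.
  by rewrite /expi cosN sinN; apply/eqP; rewrite eq_complex /= opprK !eqxx.
rewrite cj nat_case.
have -> : (2 %| - n.+1%:Z)%Z = (2 %| n.+1%:Z)%Z by lia.
case: ifP => _; apply/eqP; rewrite eq_complex /=;
  by rewrite ?oppr0 !eqxx.
Qed.

(** Each component is shifted by + pi or - pi according to its sign; either shift multiplies by the
    same power of -1 at integer points, so only the parity of j.1 + j.2 is left. *)
Lemma mode_bar t j : mode h (bar t) j = mode h t j * sgn j.
Proof.
rewrite !mode_char// /char /bar /=.
have b1 (a : R) : exists e : int, bar1 a = a + e%:~R * pi /\ (e = 1 \/ e = -1).
  rewrite /bar1; case: ifP => _; [exists 1|exists (-1)].
    by rewrite mul1r; split; [|left].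
  by rewrite mulN1r; split; [|right].
have [e1 [-> o1]] := b1 t.1; have [e2 [-> o2]] := b1 t.2.
rewrite [X in expi X](_ : _ =
  (j.1%:~R * t.1 + j.2%:~R * t.2) + (j.1 * e1 + j.2 * e2)%:~R * pi); last first.
  by rewrite rmorphD !rmorphM /=; ring.
rewrite expiD expi_int_pi /sgn.
suff -> : (2 %| j.1 * e1 + j.2 * e2)%Z = black j by [].
by rewrite /black; case: o1 => ->; case: o2 => ->; lia.
Qed.

(* A combination of [mode t] and [mode (bar t)] is [mode t] modulated by one
   constant on black and another on red points, which decouples the smoother. *)
Definition modul t x y : int * int -> R[i] :=
  fun j => mode h t j * (if black j then x else y).

Lemma comb_modul t c : comb h t c = modul t (c 0 0 + c 1 0) (c 0 0 - c 1 0).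
Proof.
apply/funext => j; rewrite /comb /modul mode_bar /sgn; case: (black j); ring.
Qed.

Lemma nbsum_modul t x y j :
  nbsum (modul t x y) j = mode h t j * (4 * pmode t * (if black j then y else x)).
Proof.
rewrite mulrA -nbsum_mode /nbsum /modul; have [-> -> -> ->] := black_nb j.
by rewrite !if_neg !mulrDl.
Qed.

(** The red half-step overwrites y by p x and the black one overwrites x by p (p x): the old red
    value is lost. *)
Lemma smooth_modul t x y :
  smooth h 1 (modul t x y) = modul t (pmode t ^+ 2 * x) (pmode t * x).
Proof.
have r : smooth_red h 1 (modul t x y) = modul t x (pmode t * x).
  apply/funext => j; rewrite /smooth_red; case: ifP => bj; first by rewrite /modul bj.
  by rewrite relax1// nbsum_modul /modul bj; field.
apply/funext => j; by rewrite smoothE// r !nbsum_modul /modul; case: (black j); field.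
Qed.

Lemma Kloc_modul t x y : Kloc (modul t x y) = modul t 0 (y - pmode t * x).
Proof.
apply/funext => j; rewrite /Kloc nbsum_modul /modul; case: (black j); first by rewrite mulr0.
by field.
Qed.

Lemma Lh_modul t x y : Lh h (modul t x y) =
  modul t (4 / h%:C ^+ 2 * (x - pmode t * y)) (4 / h%:C ^+ 2 * (y - pmode t * x)).
Proof.
apply/funext => j; rewrite /Lh nbsum_modul /modul fmorphV rmorphXn /=.
by case: (black j); field.
Qed.

Lemma restr_modul t x y (b : black_point) : restr_full (modul t x y) b =
  (x + pmode t * y) / 2 * inject (mode h t) b.
Proof.
by rewrite /restr_full nbsum_modul /modul /inject (valP b); field.
Qed.

Lemma interp_mode t x :
  interp (fun b => x * inject (mode h t) b) = modul t x (pmode t * x).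
Proof.
have e j : black j -> ext0 (fun b => x * inject (mode h t) b) j = modul t x (pmode t * x) j.
  by move=> bj; rewrite /ext0 insubT /= /modul bj /inject /= mulrC.
apply/funext => j; rewrite /interp; case: ifP => bj; first exact: e.
rewrite (@eq_nbsum _ _ (modul t x (pmode t * x))) => [|k]; last by rewrite bj; exact: e.
by rewrite nbsum_modul /modul bj; field.
Qed.

(** The Schur complement form of the coarse eigenvalue; 1 - p = 2 xi and 1 + p = 2 (1 - xi) turn it
    into the form with xi. *)
Definition lamH t : R[i] := 2 / h%:C ^+ 2 * (1 - pmode t ^+ 2).

Lemma LH_mode t x : LH h (fun b => x * inject (mode h t) b) =
  fun b => lamH t * (x * inject (mode h t) b).
Proof.
apply/funext => b; rewrite /LH interp_mode Lh_modul restr_modul /lamH.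
by field.
Qed.
End Modes.

(** * The mode-by-mode inverse of the coarse operator *)

Section Inverse.
Variables (R : realType) (h : R).
Hypothesis h0 : 0 < h.
Implicit Types (t : R * R) (x y : R[i]).

Lemma LH_lin (a : R[i]) (v w : black_point -> R[i]) :
  LH h (fun b => a * v b + w b) = fun b => a * LH h v b + LH h w b.
Proof.
have e j : ext0 (fun b => a * v b + w b) j = a * ext0 v j + ext0 w j.
  by rewrite /ext0; case: insub => [b|] //=; rewrite mulr0 addr0.
have i j : interp (fun b => a * v b + w b) j = a * interp v j + interp w j.
  by rewrite /interp /nbsum !e; case: ifP => _ //; ring.
apply/funext => b; rewrite /LH /restr_full /nbsum /Lh /nbsum !i; ring.
Qed.

Lemma LH_sum (I : Type) (s : seq I) (a : I -> R[i]) (v : I -> black_point -> R[i]) :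
  LH h (fun b => \sum_(i <- s) a i * v i b) = fun b => \sum_(i <- s) a i * LH h (v i) b.
Proof.
elim: s => [|i s IH].
  have -> : (fun b => \sum_(i <- [::]) a i * v i b) = fun=> 0.
    by apply/funext => b; rewrite big_nil.
  have := LH_lin (-1) (fun=> 0) (fun=> 0).
  rewrite mulr0 addr0 => ->; apply/funext => b.
  by rewrite mulN1r addNr big_nil.
under eq_fun do rewrite big_cons.
by rewrite LH_lin IH; apply/funext => b; rewrite big_cons.
Qed.

(* Polynomial functional calculus: [1/l] agrees with a polynomial on the
   finitely many eigenvalues involved, and polynomials in [LH] preserve the
   relation [sum = 0]; no independence of characters is needed. *)
Lemma LH_inv_relation (I : finType) (a l : I -> R[i]) (v : I -> black_point -> R[i]) :
  (forall i, l i != 0) -> (forall i b, LH h (v i) b = l i * v i b) ->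
  (forall b, \sum_i a i * v i b = 0) -> forall b, \sum_i a i * (l i)^-1 * v i b = 0.
Proof.
move=> l0 lv av.
have pw m : (fun b => \sum_i a i * l i ^+ m * v i b) = fun=> 0.
  elim: m => [|m IH].
    by apply/funext => b; rewrite -[RHS](av b); apply: eq_bigr => i _; rewrite mulr1.
  have := LH_sum (index_enum I) (fun i => a i * l i ^+ m) v.
  (* The empty sum gives that [LH h] maps 0 to 0; applying [LH] to the relation with exponent m then
     yields the one with exponent m + 1. *)
  rewrite IH; have := LH_sum [::] (fun i => a i) v.
  have -> : (fun b => \sum_(i <- [::]) a i * v i b) = fun=> 0.
    by apply/funext => b; rewrite big_nil.
  move=> -> E; apply/funext => b.
  have := congr1 (@^~ b) E; rewrite big_nil => /esym; apply: etrans.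
  by apply: eq_bigr => i _; rewrite lv exprSr !mulrA.
have pol (p : {poly R[i]}) b : \sum_i a i * p.[l i] * v i b = 0.
  under eq_bigr do rewrite horner_coef mulr_sumr mulr_suml.
  rewrite exchange_big /=; apply: big1 => m _.
  have /= pwm := congr1 (@^~ b) (pw m).
  rewrite (eq_bigr (fun i => p`_m * (a i * l i ^+ m * v i b))) => [|i _]; last by ring.
  by rewrite -mulr_sumr pwm mulr0.
(* q is 1 at 0 and 0 at every eigenvalue, so 1 - q is divisible by X and the quotient p takes the
   value 1 / l i at l i. *)
pose q : {poly R[i]} := \prod_(i : I) (1 - (l i)^-1 *: 'X).
have q1 : q.[0] = 1.
  rewrite /q horner_prod; apply: big1 => i _.
  by rewrite hornerD hornerN hornerC hornerZ hornerX mulr0 subr0.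
have ql i : q.[l i] = 0.
  by rewrite /q horner_prod (bigD1 i)//=
    hornerD hornerN hornerC hornerZ hornerX mulVf// subrr mul0r.
have /factor_theorem[p pq] : root (1 - q) 0.
  by rewrite /root hornerD hornerN hornerC q1 subrr.
move=> b; rewrite -[RHS](pol p b); apply: eq_bigr => i _; congr (_ * _ * _).
apply: (mulIf (l0 i)); rewrite mulVf//.
by have := congr1 (horner^~ (l i)) pq;
  rewrite hornerM hornerXsubC hornerD hornerN hornerC ql !subr0.
Qed.

(** Subtracting two expansions of v gives a vanishing combination indexed by the disjoint union of
    their index sets, to which [LH_inv_relation] applies. This determines the value chosen by
    [xget]. *)
Lemma LHinv_spec_unique v w w' : LHinv_spec h v w -> LHinv_spec h v w' -> w = w'.
Proof.
move=> [n [th [c [l [_ l0 lv vE wE]]]]] [n' [th' [c' [l' [_ l0' lv' vE' wE']]]]].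
pose a (i : 'I_n + 'I_n') := match i with inl k => c k | inr k => - c' k end.
pose ll (i : 'I_n + 'I_n') := match i with inl k => l k | inr k => l' k end.
pose vv (i : 'I_n + 'I_n') : black_point -> R[i] :=
  match i with inl k => inject (mode h (th k)) | inr k => inject (mode h (th' k)) end.
have := @LH_inv_relation _ a ll vv; move=> H; apply/funext => b.
have {H} := H _ _ _ b; rewrite big_sumType /= => H.
apply/eqP; rewrite -subr_eq0 wE wE' -sumrN; apply/eqP; rewrite -[RHS]H.
- by congr (_ + _); apply: eq_bigr => k _; rewrite !mulNr.
- by case.
- by case.
- move=> d; rewrite big_sumType /= -vE.
  under eq_bigr do rewrite mulNr.
  by rewrite sumrN -vE' subrr.
Qed.

Lemma LHinv_mode t x : low_nz t -> lamH h t != 0 ->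
  LHinv h (fun b => x * inject (mode h t) b) =
  fun b => x * (lamH h t)^-1 * inject (mode h t) b.
Proof.
move=> tl l0; have sp : LHinv_spec h (fun b => x * inject (mode h t) b)
    (fun b => x * (lamH h t)^-1 * inject (mode h t) b).
  exists 1%N, (fun=> t), (fun=> x), (fun=> lamH h t); split => // [_ b|b|b].
  - have := congr1 (@^~ b) (LH_mode h0 t 1) => /=.
    rewrite mul1r => <-; congr (LH h _ b); apply/funext => b'.
    by rewrite mul1r.
  - by rewrite big_ord1.
  - by rewrite big_ord1.
rewrite /LHinv; case: xgetP => [w -> /= sw|/(_ _ sp)//].
exact: (LHinv_spec_unique sw sp).
Qed.

(** In the box, xi = 0 kills both sines and forces the origin; xi = 1 kills both cosines and forces
    (- pi, - pi), whose component sum - 2 pi is too small for [low]. *)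
Lemma xi_neq t : low_nz t -> xi t != 0 /\ xi t != 1.
Proof.
move=> [[tb lb] tn0].
move: tb => /andP[/andP[a1 a2] /andP[b1 b2]].
have s0 (a : R) : - pi <= a -> a < pi -> sin (a / 2) = 0 -> a = 0.
  move=> aL aU sa; have [a0|a0|//] := ltgtP a 0.
  - have : 0 < sin (- (a / 2)) by apply: sin_gt0_pi; lra.
    by rewrite sinN sa oppr0 ltxx.
  - have : 0 < sin (a / 2) by apply: sin_gt0_pi; lra.
    by rewrite sa ltxx.
have c0 (a : R) : - pi <= a -> a < pi -> cos (a / 2) = 0 -> a = - pi.
  move=> aL aU ca; move: aL; rewrite le_eqVlt => /predU1P[//|aL].
  have : 0 < cos (a / 2) by apply: cos_gt0_pihalf; lra.
  by rewrite ca ltxx.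
split; apply/eqP => x0.
- apply: tn0; rewrite [t]surjective_pairing.
  have p1 := sqr_ge0 (sin (t.1 / 2)); have p2 := sqr_ge0 (sin (t.2 / 2)).
  have e1 : sin (t.1 / 2) ^+ 2 = 0 by move: x0; rewrite /xi; lra.
  have e2 : sin (t.2 / 2) ^+ 2 = 0 by move: x0; rewrite /xi; lra.
  have z1 : t.1 = 0 by apply: s0 => //; apply/eqP; rewrite -sqrf_eq0 e1 eqxx.
  have z2 : t.2 = 0 by apply: s0 => //; apply/eqP; rewrite -sqrf_eq0 e2 eqxx.
  by rewrite z1 z2.
- have p1 := sqr_ge0 (cos (t.1 / 2)); have p2 := sqr_ge0 (cos (t.2 / 2)).
  have q1 := cos2Dsin2 (t.1 / 2); have q2 := cos2Dsin2 (t.2 / 2).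
  have e1 : cos (t.1 / 2) ^+ 2 = 0 by move: x0; rewrite /xi; lra.
  have e2 : cos (t.2 / 2) ^+ 2 = 0 by move: x0; rewrite /xi; lra.
  have t1 : t.1 = - pi by apply: c0 => //; apply/eqP; rewrite -sqrf_eq0 e1 eqxx.
  have t2 : t.2 = - pi by apply: c0 => //; apply/eqP; rewrite -sqrf_eq0 e2 eqxx.
  move: lb => /andP[_ /andP[/= lb _]]; move: lb; rewrite t1 t2.
  by have := pi_gt0 R; lra.
Qed.

Lemma lamHE t : lamH h t = (8 / h ^+ 2 * (xi t * (1 - xi t)))%:C.
Proof.
have hn : h != 0 by rewrite gt_eqF.
rewrite /lamH /pmode -(rmorph_nat (@real_complex R) 2) -(rmorph1 (@real_complex R)).
rewrite -!rmorphXn -rmorphB -fmorphV -!rmorphM /=; congr (_%:C).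
by field.
Qed.

Lemma lamH_neq0 t : low_nz t -> lamH h t != 0.
Proof.
move=> /xi_neq[x0 x1]; rewrite lamHE (inj_eq (@complexI R) _ 0); apply: mulf_neq0.
  by rewrite gt_eqF// divr_gt0// exprn_gt0.
by rewrite mulf_neq0// subr_eq0 eq_sym.
Qed.

(** In the restricted residual (x - p y) + p (y - p x) = (1 - p^2) x the red value cancels, leaving
    [lamH] times x; the inverse gives back x, whose interpolation is x on black and p x on red
    points. *)
Lemma Kop_modul t x y : low_nz t -> Kop h (modul h t x y) = Kloc (modul h t x y).
Proof.
move=> tl; have l0 := lamH_neq0 tl.
rewrite Kloc_modul// /Kop Lh_modul//.
have -> : restr_full (modul h t (4 / h%:C ^+ 2 * (x - pmode t * y))
    (4 / h%:C ^+ 2 * (y - pmode t * x))) =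
    fun b => lamH h t * x * inject (mode h t) b.
  apply/funext => b; rewrite restr_modul// /lamH.
  have hC : h%:C != 0 by rewrite (inj_eq (@complexI R)) gt_eqF.
  by field.
rewrite LHinv_mode// interp_mode//; apply/funext => j.
rewrite /modul (mulrAC _ x) divff// mul1r; case: (black j); ring.
Qed.


Lemma Mop_modul nu1 nu2 t x y : low_nz t ->
  Mop h nu1 nu2 (modul h t x y) = Gloc h nu1 nu2 (modul h t x y).
Proof.
move=> tl; rewrite /Mop /Gloc; congr (iter nu2 _ _).
have [x' [y' ->]] : exists x' y', iter nu1 (smooth h 1) (modul h t x y) = modul h t x' y'.
  elim: nu1 => [|n [x' [y' IH]]]; first by exists x, y.
  by rewrite iterS IH smooth_modul//; eexists; eexists.
exact: Kop_modul.
Qed.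
End Inverse.

(** * The 2 x 2 symbols and the exceptional frequencies *)

Section Matrices.
Variables (R : realType) (h : R).
Hypothesis h0 : 0 < h.
Implicit Types (t : R * R) (c v w : 'cV[R[i]]_2).

Lemma ord2_sum (F : 'I_2 -> R[i]) : \sum_i F i = F 0 + F 1.
Proof. by rewrite !big_ord_recl big_ord0 addr0; congr (_ + F _); apply/val_inj. Qed.

Lemma col2P v w : v 0 0 = w 0 0 -> v 1 0 = w 1 0 -> v = w.
Proof.
move=> e0 e1; apply/matrixP => i j; rewrite ord1.
by case: i => [[|[|//]] ilt]; [rewrite (_ : Ordinal ilt = 0)|rewrite (_ : Ordinal ilt = 1)] => //;
  apply/val_inj.
Qed.

Lemma mx22_mul (a b c' d : R[i]) v :
  ((mx22 a b c' d *m v) 0 0 = a * v 0 0 + b * v 1 0) *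
  ((mx22 a b c' d *m v) 1 0 = c' * v 0 0 + d * v 1 0).
Proof. by split; rewrite mxE ord2_sum !mxE. Qed.

Lemma subr1mx_mul (A : 'M[R[i]]_2) v i : ((1%:M - A) *m v) i 0 = v i 0 - (A *m v) i 0.
Proof. by rewrite mulmxBl mul1mx !mxE. Qed.

Lemma SRmx_mul t c :
  ((SRmx t *m c) 0 0 = c 0 0 - ((xi t)%:C * c 0 0 - (1 - xi t)%:C * c 1 0)) *
  ((SRmx t *m c) 1 0 = c 1 0 + ((xi t)%:C * c 0 0 - (1 - xi t)%:C * c 1 0)).
Proof.
by rewrite /SRmx !subr1mx_mul -!mulmxA /Dmx !mx22_mul; split; ring.
Qed.

Lemma SBmx_mul t c :
  ((SBmx t *m c) 0 0 = c 0 0 - ((xi t)%:C * c 0 0 + (1 - xi t)%:C * c 1 0)) *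
  ((SBmx t *m c) 1 0 = c 1 0 - ((xi t)%:C * c 0 0 + (1 - xi t)%:C * c 1 0)).
Proof.
by rewrite /SBmx !subr1mx_mul -!mulmxA /Dmx !mx22_mul; split; ring.
Qed.

Lemma pmodeE t : pmode t = 1 - 2 * (xi t)%:C.
Proof. by rewrite /pmode rmorphB rmorphM rmorph1 rmorph_nat. Qed.

Lemma eq_modul t x y x' y' : x = x' -> y = y' -> modul h t x y = modul h t x' y'.
Proof. by move=> -> ->. Qed.

Lemma comb_SBmx t c : comb h t (SBmx t *m c) =
  modul h t (c 0 0 + c 1 0 - 2 * ((xi t)%:C * c 0 0 + (1 - xi t)%:C * c 1 0))
    (c 0 0 - c 1 0).
Proof. by rewrite (comb_modul h0) !SBmx_mul; apply: eq_modul; ring. Qed.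

Lemma smooth_comb t c : smooth h 1 (comb h t c) = comb h t (Smx t *m c).
Proof.
rewrite /Smx -mulmxA comb_SBmx (comb_modul h0) (smooth_modul h0).
by rewrite !SRmx_mul pmodeE rmorphB rmorph1; apply: eq_modul; ring.
Qed.

Lemma iter_smooth_comb n t c :
  iter n (smooth h 1) (comb h t c) = comb h t (Smx t ^+ n *m c).
Proof.
elim: n => [|n IH]; first by rewrite expr0 mul1mx.
by rewrite iterS IH smooth_comb mulmxA exprS.
Qed.

Lemma restr_mx_mul t c : (restr_mx t *m c) 0 0 = (1 - xi t)%:C * c 0 0 + (xi t)%:C * c 1 0.
Proof. by rewrite mxE ord2_sum !mxE. Qed.

Lemma Lmx_mul t c :
  ((Lmx h t *m c) 0 0 = (8 / h ^+ 2)%:C * ((xi t)%:C * c 0 0)) *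
  ((Lmx h t *m c) 1 0 = (8 / h ^+ 2)%:C * ((1 - xi t)%:C * c 1 0)).
Proof.
rewrite /Lmx /Dmx -!scalemxAl; split; rewrite mxE mx22_mul; congr (_ * _); ring.
Qed.

Lemma LHhatE t : LHhat h t = (8 / h ^+ 2 * (xi t * (1 - xi t)))%:C.
Proof.
rewrite /LHhat -mulmxA restr_mx_mul !Lmx_mul !mxE /=.
by move: (xi t) (8 / h ^+ 2) => x k; rewrite !rmorphM !rmorphB !rmorph1; ring.
Qed.

Lemma LHhat_lamH t : LHhat h t = lamH h t. Proof. by rewrite LHhatE lamHE. Qed.

(** [Kmx] is the rank-one product of the column (1, -1) and the row (xi, xi - 1); the column spans
    the combinations that vanish at black points, in agreement with [Kloc]. The factor xi (1 - xi)
    of [LHhat] cancels because it is nonzero on [low_nz]. *)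
Lemma Kmx_mul t c : low_nz t ->
  ((Kmx h t *m c) 0 0 = (xi t)%:C * c 0 0 - (1 - xi t)%:C * c 1 0) *
  ((Kmx h t *m c) 1 0 = - ((xi t)%:C * c 0 0 - (1 - xi t)%:C * c 1 0)).
Proof.
move=> tl; have [x0 x1] := xi_neq tl.
have X0 : (xi t)%:C != 0 by rewrite (inj_eq (@complexI R) _ 0).
have X1 : 1 - (xi t)%:C != 0.
  by rewrite -(rmorph1 (@real_complex R)) subr_eq0 (inj_eq (@complexI R)) eq_sym.
have hC : h%:C != 0 by rewrite (inj_eq (@complexI R) _ 0) gt_eqF.
have E i : (interp_mx t *m restr_mx t *m Lmx h t *m c) i 0 =
    interp_mx t i 0 * ((8 / h ^+ 2)%:C * ((xi t)%:C * (1 - (xi t)%:C) * (c 0 0 + c 1 0))).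
  rewrite -!mulmxA [LHS]mxE big_ord1; congr (_ * _).
  by rewrite restr_mx_mul !Lmx_mul rmorphB rmorph1; ring.
have Z (a : R[i]) (B : 'M[R[i]]_2) i : (a *: B *m c) i 0 = a * (B *m c) i 0.
  by rewrite -scalemxAl mxE.
have i0 : interp_mx t 0 0 = 1 - (xi t)%:C by rewrite !mxE /= rmorphB rmorph1.
have i1 : interp_mx t 1 0 = (xi t)%:C by rewrite !mxE.
have L : LHhat h t = (8 / h ^+ 2)%:C * ((xi t)%:C * (1 - (xi t)%:C)).
  by rewrite LHhatE -(rmorph1 (@real_complex R)) -rmorphB -!rmorphM.
rewrite /Kmx !subr1mx_mul !Z !E i0 i1 L rmorphB rmorph1.
by split; field; apply/and3P; split.
Qed.

Lemma Kloc_comb t c : low_nz t -> Kloc (comb h t c) = comb h t (Kmx h t *m c).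
Proof.
move=> tl; rewrite !(comb_modul h0) (Kloc_modul h0).
have [e0 e1] := Kmx_mul c tl; move: (Kmx h t *m c) e0 e1 => v e0 e1.
rewrite e0 e1 pmodeE rmorphB rmorph1.
by apply: eq_modul; ring.
Qed.

Lemma Gloc_comb nu1 nu2 t c : low_nz t ->
  Gloc h nu1 nu2 (comb h t c) = comb h t (Mmx h nu1 nu2 t *m c).
Proof.
by move=> tl; rewrite /Gloc iter_smooth_comb (Kloc_comb _ tl) iter_smooth_comb /Mmx !mulmxA.
Qed.

Lemma Mop_comb nu1 nu2 t : low_nz t ->
  has_matrix h t (Mop h nu1 nu2) (Mmx h nu1 nu2 t).
Proof. by move=> tl c; rewrite -(Gloc_comb _ _ _ tl) (comb_modul h0) (Mop_modul h0 _ _ _ _ tl). Qed.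

Lemma mode_neq0 t j : mode h t j != 0.
Proof.
rewrite mode_char//; apply/eqP => c0.
have := charD j (- j) t; rewrite c0 mul0r subrr.
rewrite /char !mul0r addr0 /expi cos0 sin0 => /eqP.
by rewrite eq_complex /= oner_eq0.
Qed.

(** One black and one red point suffice: they give the sum and the difference of the two
    coefficients. *)
Lemma comb_inj t c : comb h t c = (fun=> 0) -> c = 0.
Proof.
rewrite (comb_modul h0) => e.
have := congr1 (@^~ (0, 0)) e; have := congr1 (@^~ (1, 0)) e.
rewrite /modul /black /= => /eqP; rewrite mulf_eq0 (negbTE (mode_neq0 _ _)) /= => /eqP e1.
move=> /eqP; rewrite mulf_eq0 (negbTE (mode_neq0 _ _)) /= => /eqP e2.
have two : (2 : R[i]) != 0 by rewrite pnatr_eq0.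
apply: col2P; rewrite !mxE; apply: (mulfI two); rewrite mulr0.
- by rewrite -[RHS](addr0 0) -[X in X + _]e1 -e2; ring.
- by rewrite -[RHS](subr0 0) -[X in X - _]e2 -e1; ring.
Qed.

Lemma LH_eigen t b : LH h (inject (mode h t)) b = LHhat h t * inject (mode h t) b.
Proof.
have := congr1 (@^~ b) (LH_mode h0 t 1) => /=; rewrite mul1r LHhat_lamH => <-.
by congr (LH h _ b); apply/funext => b'; rewrite mul1r.
Qed.

Lemma bar1_eq0 (a : R) : - pi <= a -> a < pi -> bar1 a = 0 -> a = - pi.
Proof. by move=> a1 a2; rewrite /bar1; case: ifP => _; lra. Qed.

(** [low] is a half-open diamond with its vertices on the axes, and [bar] translates the four corner
    triangles of the box into it; (- pi, - pi) is the point that [bar] sends to the origin. *)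
Lemma low_nz_or_bar t : box t -> t <> (0, 0) -> t <> (- pi, - pi) ->
  low_nz t \/ low_nz (bar t).
Proof.
case: t => a b tb tn0 tnpi; have p0 := pi_gt0 R.
have [tl|tnl] := pselect (low (a, b)); [by left|right].
have {}tnl : ~~ [&& - pi <= a - b, a - b < pi, - pi <= a + b & a + b < pi].
  by apply/negP => /and4P[? ? ? ?]; apply: tnl; split => //; apply/andP; split; apply/andP.
move: tb => /andP[/= /andP[a1 a2] /andP[b1 b2]].
split.
  clear tn0 tnpi; move: tnl; rewrite !negb_and -!ltNge -!leNgt /bar /bar1 /low /box /=.
  case: (ltP a 0) => a0; case: (ltP b 0) => b0 /or4P[] ?; split => //=;
    apply/andP; split; apply/andP; split; lra.
rewrite /bar /= => -[/(bar1_eq0 a1 a2) ea /(bar1_eq0 b1 b2) eb].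
by apply: tnpi; rewrite ea eb.
Qed.

Lemma mode_bar_modul t : mode h t = modul h (bar t) 1 (-1).
Proof.
apply/funext => j; rewrite /modul mode_bar// -mulrA /sgn.
by case: (black j); rewrite ?mulr1// mulrN1 opprK mulr1.
Qed.

Lemma mode_modul t : mode h t = modul h t 1 1.
Proof. by apply/funext => j; rewrite /modul if_same mulr1. Qed.

Lemma Mop_mode nu1 nu2 t : box t -> t <> (0, 0) -> t <> (- pi, - pi) ->
  Mop h nu1 nu2 (mode h t) = Gloc h nu1 nu2 (mode h t).
Proof.
move=> tb t0 tpi; have [tl|tl] := low_nz_or_bar tb t0 tpi.
  by rewrite mode_modul Mop_modul.
by rewrite mode_bar_modul Mop_modul.
Qed.
End Matrices.

(** * Operators on square-summable grid functions *)

Section Boundedness.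
Variable R : realType.
Implicit Types (u v w : int * int -> R[i]) (j : int * int) (a : R[i])
  (A B : (int * int -> R[i]) -> int * int -> R[i]).

Lemma le_esumM (T : choiceType) (f : T -> \bar R) (c : R) : 0 <= c ->
  (forall i, 0 <= f i)%E ->
  (\esum_(i in [set: T]) (c%:E * f i) <= c%:E * \esum_(i in [set: T]) f i)%E.
Proof.
move=> c0 f0; apply: ge_ereal_sup => _ [X [finX XT] <-].
rewrite -ge0_mule_fsumr//; apply: lee_wpmul2l; first by rewrite lee_fin.
by apply: ereal_sup_ubound; exists X.
Qed.

Lemma l2sq_ge0 u : (0 <= l2sq u)%E.
Proof. by apply: esum_ge0 => j _; rewrite lee_fin sqr_ge0. Qed.

Lemma normc_real (x : R) : normc x%:C ^+ 2 = x ^+ 2.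
Proof. by rewrite sqr_normcE /= expr0n addr0. Qed.

Lemma sqr_normcD (x y : R[i]) :
  normc (x + y) ^+ 2 <= 2 * normc x ^+ 2 + 2 * normc y ^+ 2.
Proof.
rewrite !sqr_normcE; case: x y => a b [c d] /=.
have := sqr_ge0 (a - c); have := sqr_ge0 (b - d); nra.
Qed.

Lemma l2sq_axpy a u v :
  (l2sq (fun j => (a * u j + v j)%R) <= (2 * normc a ^+ 2)%:E * l2sq u + 2%:E * l2sq v)%E.
Proof.
have c0 : 0 <= 2 * normc a ^+ 2 by rewrite mulr_ge0// sqr_ge0.
have n0 w j : (0 <= (normc (w j) ^+ 2)%:E)%E by rewrite lee_fin sqr_ge0.
apply: le_trans (leeD (le_esumM c0 (n0 u)) (le_esumM _ (n0 v))) => //.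
rewrite -esumD; last 2 first.
- by move=> j _; rewrite mule_ge0.
- by move=> j _; rewrite mule_ge0.
apply: le_esum => j _; rewrite -!EFinM -EFinD lee_fin.
by apply: le_trans (sqr_normcD _ _) _; rewrite normcM exprMn mulrA.
Qed.

Lemma l2_axpy a u v : l2 u -> l2 v -> l2 (fun j => a * u j + v j).
Proof.
move=> u2 v2; apply: le_lt_trans (l2sq_axpy a u v) _.
apply: lte_add_pinfty; apply: lte_mul_pinfty => //; rewrite ?lee_fin//.
by rewrite mulr_ge0// sqr_ge0.
Qed.

Lemma l2_0 : l2 (fun=> 0 : R[i]).
Proof.
rewrite /l2 /= /l2sq esum1// => j _.
by rewrite normc0 expr0n.
Qed.

Lemma bounded_l2_l2 A u : bounded_l2 A -> l2 u -> l2 (A u).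
Proof.
move=> [_ [C hC]] u2; apply: le_lt_trans (hC u u2) _.
have : l2sq u \is a fin_num by rewrite ge0_fin_numE ?l2sq_ge0.
by move=> /fineK <-; rewrite -EFinM ltry.
Qed.

Lemma bounded_l2_bound A : bounded_l2 A ->
  exists2 C : R, 0 <= C & forall u, l2 u -> (l2sq (A u) <= C%:E * l2sq u)%E.
Proof.
move=> [_ [C hC]]; exists `|C| => // u u2; apply: le_trans (hC u u2) _.
by apply: lee_wpmul2r; [exact: l2sq_ge0|rewrite lee_fin ler_norm].
Qed.

Lemma bounded_l2_comp A B : bounded_l2 A -> bounded_l2 B -> bounded_l2 (A \o B).
Proof.
move=> bA bB; have [CA CA0 hA] := bounded_l2_bound bA; have [CB CB0 hB] := bounded_l2_bound bB.
split=> [a u v u2 v2|].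
  by rewrite /= bB.1// bA.1//; exact: bounded_l2_l2.
exists (CA * CB) => u u2; apply: le_trans (hA _ (bounded_l2_l2 bB u2)) _.
by rewrite EFinM -muleA; apply: lee_wpmul2l; [rewrite lee_fin|exact: hB].
Qed.

Lemma bounded_l2_id : bounded_l2 (@id (int * int -> R[i])).
Proof. by split=> //; exists 1 => u _; rewrite mul1e. Qed.

Lemma bounded_l2_iter A n : bounded_l2 A -> bounded_l2 (iter n A).
Proof.
move=> bA; elim: n => [|n IH]; first exact: bounded_l2_id.
exact: (bounded_l2_comp bA IH).
Qed.

Lemma eq_bounded_l2 A B : (forall u, l2 u -> A u = B u) -> bounded_l2 B -> bounded_l2 A.
Proof.
move=> AB [lB [C hC]]; split=> [a u v u2 v2|].
  by rewrite !AB//; [exact: lB|exact: l2_axpy].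
by exists C => u u2; rewrite AB//; exact: hC.
Qed.

Lemma bounded_l2_lincomb (a b : R[i]) A : bounded_l2 A ->
  bounded_l2 (fun u j => a * A u j + b * u j).
Proof.
move=> bA; have [C C0 hC] := bounded_l2_bound bA; split=> [c u v u2 v2|].
  by apply/funext => j; rewrite bA.1//; ring.
exists (2 * normc a ^+ 2 * C + 2 * (2 * normc b ^+ 2)) => u u2.
apply: le_trans (l2sq_axpy _ _ _) _.
have n1 : 0 <= 2 * normc a ^+ 2 * C by rewrite mulr_ge0// mulr_ge0// sqr_ge0.
have n2 : 0 <= 2 * (2 * normc b ^+ 2) by rewrite mulr_ge0// mulr_ge0// sqr_ge0.
rewrite (EFinD (_ * C)) ge0_muleDl ?lee_fin//.
apply: leeD.
  rewrite (EFinM _ C) -muleA; apply: lee_wpmul2l; last exact: hC.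
  by rewrite lee_fin mulr_ge0// sqr_ge0.
rewrite (EFinM 2 (2 * _)) -muleA; apply: lee_wpmul2l; first by rewrite lee_fin.
have := l2sq_axpy b u (fun=> 0).
have -> : l2sq (fun=> 0 : R[i]) = 0%E by rewrite /l2sq esum1// => j _; rewrite normc0 expr0n.
rewrite mule0 adde0; apply: le_trans.
by apply: le_esum => j _; rewrite addr0.
Qed.

Lemma sqr_normc_nbsum u j : normc (nbsum u j / 4) ^+ 2 <=
  normc (u (east j)) ^+ 2 + normc (u (west j)) ^+ 2
  + normc (u (north j)) ^+ 2 + normc (u (south j)) ^+ 2.
Proof.
have -> : nbsum u j / 4 = nbsum u j * (4^-1)%:C by rewrite fmorphV rmorph_nat.
rewrite normcM exprMn normc_real /nbsum.
case: (u (east j)) (u (west j)) (u (north j)) (u (south j)) => a a' [b b'] [c c'] [d d'].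
rewrite !sqr_normcE /=.
have q (x y z t : R) : (x + y + z + t) ^+ 2 * 4^-1 ^+ 2 <= x ^+ 2 + y ^+ 2 + z ^+ 2 + t ^+ 2.
  have := sqr_ge0 (x - y); have := sqr_ge0 (z - t); have := sqr_ge0 (x + y - z - t).
  have := sqr_ge0 (x + y + z + t); nra.
have := q a b c d; have := q a' b' c' d'; nra.
Qed.

(** Each neighbour contributes a bijective shift of u, of the same norm. The constant is 10 = 2 (1 +
    4): the point itself and its four neighbours, doubled. *)
Lemma bounded_l2_stencil A :
  (forall a u v, A (fun j => a * u j + v j) = fun j => a * A u j + A v j) ->
  (forall u j, normc (A u j) ^+ 2 <= 2 * normc (u j) ^+ 2 + 2 * normc (nbsum u j / 4) ^+ 2) ->
  bounded_l2 A.
Proof.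
move=> lA bA; split=> //; exists 10 => u u2.
pose f j := (normc (u j) ^+ 2)%:E.
have f0 j : (0 <= f j)%E by rewrite lee_fin sqr_ge0.
have sh (s : int * int -> int * int) : bijective s ->
    \esum_(j in [set: int * int]) f (s j) = l2sq u.
  by move=> bs; rewrite /l2sq [RHS](reindex_esum [set: int * int] _ s)// setTT_bijective.
have be : bijective east by exists west => -[x y]; rewrite /east /west /= ?subrK ?addrK.
have bw : bijective west by exists east => -[x y]; rewrite /east /west /= ?subrK ?addrK.
have bn : bijective north by exists south => -[x y]; rewrite /north /south /= ?subrK ?addrK.
have bs : bijective south by exists north => -[x y]; rewrite /north /south /= ?subrK ?addrK.
pose g j := (f j + (f (east j) + f (west j) + f (north j) + f (south j)))%E.
have g0 j : (0 <= g j)%E by rewrite !adde_ge0.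
apply: (@le_trans _ _ (\esum_(j in [set: int * int]) (2%:E * g j))%E).
  apply: le_esum => j _; rewrite /g /f -!EFinD -EFinM lee_fin.
  apply: le_trans (bA u j) _; rewrite mulrDr lerD2l ler_wpM2l//.
  exact: sqr_normc_nbsum.
apply: le_trans (le_esumM _ g0) _ => //.
rewrite !esumD//; do ?by move=> j _; rewrite ?adde_ge0.
rewrite (sh _ be) (sh _ bw) (sh _ bn) (sh _ bs) -/(l2sq u).
have : l2sq u \is a fin_num by rewrite ge0_fin_numE ?l2sq_ge0.
move=> /fineK <-; rewrite -!EFinD -!EFinM lee_fin.
by rewrite le_eqVlt; apply/orP; left; apply/eqP; ring.
Qed.

Lemma nbsum_lin a u v j :
  nbsum (fun j => a * u j + v j) j = a * nbsum u j + nbsum v j.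
Proof. by rewrite /nbsum; ring. Qed.

Lemma bounded_Kloc : bounded_l2 (@Kloc R).
Proof.
apply: bounded_l2_stencil => [a u v|u j].
  apply/funext => j; rewrite /Kloc nbsum_lin; case: ifP => _; ring.
rewrite /Kloc; case: ifP => _.
  by rewrite normc0 expr0n addr_ge0// mulr_ge0// sqr_ge0.
by apply: le_trans (sqr_normcD _ _) _; rewrite normcN.
Qed.

Variable h : R.
Hypothesis h0 : 0 < h.

Let relax_bound u j : normc (relax h 1 u j) ^+ 2 <=
  2 * normc (u j) ^+ 2 + 2 * normc (nbsum u j / 4) ^+ 2.
Proof.
rewrite relax1//; have := sqr_ge0 (normc (u j)).
have := sqr_ge0 (normc (nbsum u j / 4)); lra.
Qed.

Let id_bound u j : normc (u j) ^+ 2 <=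
  2 * normc (u j) ^+ 2 + 2 * normc (nbsum u j / 4) ^+ 2.
Proof.
have := sqr_ge0 (normc (u j)); have := sqr_ge0 (normc (nbsum u j / 4)); lra.
Qed.

Lemma bounded_smooth : bounded_l2 (smooth h 1).
Proof.
apply: (@bounded_l2_comp (smooth_black h 1) (smooth_red h 1)).
- apply: bounded_l2_stencil => [a u v|u j].
    apply/funext => j; rewrite /smooth_black !relax1// nbsum_lin; case: ifP => _ //; ring.
  by rewrite /smooth_black; case: ifP.
- apply: bounded_l2_stencil => [a u v|u j].
    apply/funext => j; rewrite /smooth_red !relax1// nbsum_lin; case: ifP => _ //; ring.
  by rewrite /smooth_red; case: ifP.
Qed.

Lemma bounded_Gloc nu1 nu2 : bounded_l2 (Gloc h nu1 nu2).
Proof.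
apply: (@bounded_l2_comp (iter nu2 (smooth h 1)) _ (bounded_l2_iter _ bounded_smooth)).
exact: (bounded_l2_comp bounded_Kloc (bounded_l2_iter nu1 bounded_smooth)).
Qed.
End Boundedness.

(** * Local operators under the Fourier integral *)

Section FourierOperators.
Variable R : realType.
Implicit Types (f : R * R -> R[i]) (k : R * R -> int * int -> R[i])
  (u w : int * int -> R[i]) (A : (int * int -> R[i]) -> int * int -> R[i])
  (j : int * int) (t : R * R).

(** Integrability is carried along with the value because the additivity of [integral_box] asks for
    it at every grid point. *)
Definition superposition f k w : Prop := forall j,
  integrableC (fun t => f t * k t j) /\ integral_box (fun t => f t * k t j) = w j.

(** The coefficients depend on the grid point and not on the frequency, so [A] is a finite linear
    combination of values and commutes with the integral. *)
Lemma superposition_stencil f k w A (al be : int * int -> R[i]) :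
  (forall u j, A u j = al j * u j + be j * nbsum u j) ->
  superposition f k w -> superposition f (fun t => A (k t)) (A w).
Proof.
move=> AE fkw j.
have [ij ej] := fkw j; have [ie ee] := fkw (east j); have [iw ew] := fkw (west j).
have [i_n en] := fkw (north j); have [i_s es] := fkw (south j).
have i4 := integrableCD (integrableCD (integrableCD ie iw) i_n) i_s.
have iA := integrableCD (integrableCZ (al j) ij) (integrableCZ (be j) i4).
have -> : (fun t => f t * A (k t) j) = fun t => al j * (f t * k t j) +
    be j * (f t * k t (east j) + f t * k t (west j) + f t * k t (north j)
            + f t * k t (south j)).
  by apply/funext => t; rewrite AE /nbsum; ring.
split=> //.
have i2 := integrableCD ie iw; have i3 := integrableCD i2 i_n.
rewrite integral_boxD ?integral_boxZ//; last 2 first.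
- exact: integrableCZ.
- exact: integrableCZ.
by rewrite integral_boxD// integral_boxD// integral_boxD// ej ee ew en es AE /nbsum.
Qed.

Lemma superposition_Gloc (h : R) nu1 nu2 f k w : 0 < h -> superposition f k w ->
  superposition f (fun t => Gloc h nu1 nu2 (k t)) (Gloc h nu1 nu2 w).
Proof.
move=> h0.
have sS k' w' : superposition f k' w' ->
    superposition f (fun t => smooth h 1 (k' t)) (smooth h 1 w').
  move=> s; apply: (@superposition_stencil _ _ _ (smooth_black h 1)
    (fun j => (~~ black j)%:R) (fun j => (black j)%:R / 4)).
    by move=> u j; rewrite /smooth_black relax1//; case: (black j) => /=; field.
  apply: (@superposition_stencil _ _ _ (smooth_red h 1)
    (fun j => (black j)%:R) (fun j => (~~ black j)%:R / 4)) => // u j.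
  by rewrite /smooth_red relax1//; case: (black j) => /=; field.
have sI n k' w' : superposition f k' w' ->
    superposition f (fun t => iter n (smooth h 1) (k' t)) (iter n (smooth h 1) w').
  by elim: n => //= n IH s; apply: sS; exact: IH.
move=> s; apply: (sI).
apply: (@superposition_stencil _ _ _ (@Kloc R)
  (fun j => (~~ black j)%:R) (fun j => - ((~~ black j)%:R / 4))).
  by move=> u j; rewrite /Kloc; case: (black j) => /=; field.
exact: sI.
Qed.

Lemma leb2_point (p : R * R) : leb2 ([set p] : set (measurableTypeR R * measurableTypeR R)) = 0%E.
Proof.
have -> : [set p] = [set p.1] `*` [set p.2].
  by apply/seteqP; split => [_ -> //|[x y] /= [-> ->]]; rewrite -surjective_pairing.
rewrite [LHS](@product_measure1E _ _ _ _ _ lebesgue_measure lebesgue_measure)//=.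
by rewrite lebesgue_measure_set1 mul0e.
Qed.

Lemma measurable_point (p : R * R) :
  measurable ([set p] : set (measurableTypeR R * measurableTypeR R)).
Proof.
have -> : [set p] = [set p.1] `*` [set p.2].
  by apply/seteqP; split => [_ -> //|[x y] /= [-> ->]]; rewrite -surjective_pairing.
by apply: measurableX; exact: measurable_set1.
Qed.

Definition point_indic (p t : R * R) : R[i] := (\1_[set p] t)%:C.

Lemma integrableC_point p : integrableC (point_indic p).
Proof.
split; last by apply: eq_integrable (integrable0 _ _) => //; exact: measurable_box.
apply: measurable_bounded_integrable; first exact: measurable_box.
- by rewrite leb2_box ltry.
- apply: measurable_funTS; apply: measurable_indic; exact: measurable_point.
- exists 1; split => // x x1 t _; apply: le_trans (ltW x1).
  by rewrite /= indicE; case: (_ \in _); rewrite /= ?normr0 ?normr1.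
Qed.

Lemma integral_box_point p : integral_box (point_indic p) = 0.
Proof.
rewrite /integral_box /Rintegral /=; congr (_ +i* _); last by rewrite integral0.
rewrite integral_indic; [|exact: measurable_box|exact: measurable_point].
rewrite (@subset_measure0 _ _ _ leb2 _ [set p])//.
- by apply: measurableI; [exact: measurable_point|exact: measurable_box].
- exact: measurable_point.
- exact: leb2_point.
Qed.

(* [Mop] and [Gloc] disagree at the frequency 0 and at its alias only. *)
Lemma Mop_l2_Gloc (h : R) nu1 nu2 u : 0 < h -> l2 u ->
  Mop_l2 h nu1 nu2 u = Gloc h nu1 nu2 u.
Proof.
move=> h0 u2; have [f0 f0P] := fourier_exists h0 u2.
have fP : fourier_repr h u (fourier h u).
  by rewrite /fourier; case: xgetP => [f -> //|/(_ _ f0P)].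
pose f := fourier h u; have [f2 fu] : fourier_repr h u f by [].
have sf : superposition f (mode h) u.
  move=> j; split; last by rewrite fu.
  have -> : (fun t => f t * mode h t j) = fun t => f t * char j t.
    by apply/funext => t; rewrite mode_char.
  exact/integrableC_mul_char/L2_box_integrableC.
have sG := superposition_Gloc nu1 nu2 h0 sf.
apply/funext => j; have [iG <-] := sG j; rewrite /Mop_l2 -/f.
pose G t := f t * Gloc h nu1 nu2 (mode h t) j.
pose M t := f t * Mop h nu1 nu2 (mode h t) j.
pose p1 : R * R := (0, 0); pose p2 : R * R := (- pi, - pi).
have p12 : p1 <> p2.
  by move=> [] /eqP; rewrite eq_sym oppr_eq0 gt_eqF// pi_gt0.
(* [N] equals [M] everywhere on the box and is visibly integrable, so the null set is handled by
   linearity, with [G] as the known integrable part. *)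
pose N t := G t + ((M p1 - G p1) * point_indic p1 t + (M p2 - G p2) * point_indic p2 t).
have i1 := integrableCZ (M p1 - G p1) (integrableC_point p1).
have i2 := integrableCZ (M p2 - G p2) (integrableC_point p2).
transitivity (integral_box N).
  have MN t : t \in box -> M t = N t.
    rewrite inE => tb; rewrite /N /point_indic !indicE.
    have [->|t1] := eqVneq t p1.
      rewrite mem_set// memNset; last exact: p12.
      by rewrite mulr1 mulr0 addr0 addrC subrK.
    have [->|t2] := eqVneq t p2.
      rewrite memNset; last by move=> /esym.
      by rewrite mem_set// mulr1 mulr0 add0r addrC subrK.
    rewrite !memNset; [|exact/eqP|exact/eqP].
    by rewrite !mulr0 !addr0 /M /G Mop_mode//; exact/eqP.
  rewrite /integral_box; congr (_ +i* _); apply: eq_Rintegral => t tb.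
  - by rewrite -/(M t) MN.
  - by rewrite -/(M t) MN.
rewrite /N integral_boxD//; last exact: integrableCD.
rewrite integral_boxD// !integral_boxZ; [|exact: integrableC_point|exact: integrableC_point].
by rewrite !integral_box_point !mulr0 !addr0.
Qed.

Lemma bounded_Mop_l2 (h : R) nu1 nu2 : 0 < h -> bounded_l2 (Mop_l2 h nu1 nu2).
Proof.
move=> h0; apply: eq_bounded_l2 (bounded_Gloc h0 nu1 nu2) => u u2.
exact: Mop_l2_Gloc.
Qed.
End FourierOperators.

(** * Spectral radius from a relation T^2 = eps T *)

Section Spectra.
Variable R : realType.
Implicit Types (u v : int * int -> R[i]) (a b z eps : R[i]) (j : int * int)
  (T : (int * int -> R[i]) -> int * int -> R[i]).

Lemma ereal_sup_normc (S : set R[i]) eps : S `<=` [set z | z = 0 \/ z = eps] ->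
  S eps -> ereal_sup [set (normc z)%:E | z in S] = (normc eps)%:E.
Proof.
move=> Ssub Seps; apply/eqP; rewrite eq_le; apply/andP; split.
  apply: ge_ereal_sup => _ [z Sz <-]; rewrite lee_fin.
  have [->|->//] := Ssub z Sz; rewrite normc0.
  by case: eps {Ssub Seps} => x y /=; exact: sqrtr_ge0.
by apply: ereal_sup_ubound; exists eps.
Qed.

Lemma bounded_l2_0 T : bounded_l2 T -> T (fun=> 0) = fun=> 0.
Proof.
move=> bT; have := bT.1 (-1) (fun=> 0) (fun=> 0) (@l2_0 R) (@l2_0 R).
rewrite mulr0 addr0 => ->; apply/funext => j; ring.
Qed.

Lemma bounded_l2_lin T a b u v : bounded_l2 T -> l2 u -> l2 v ->
  T (fun j => a * u j + b * v j) = fun j => a * T u j + b * T v j.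
Proof.
move=> bT u2 v2.
have e (w : int * int -> R[i]) : (fun j => b * w j) = fun j => b * w j + (fun=> 0 : R[i]) j.
  by apply/funext => j; rewrite addr0.
have bv2 : l2 (fun j => b * v j) by rewrite e; apply: l2_axpy => //; exact: l2_0.
rewrite bT.1// (e v) bT.1//; last exact: l2_0.
by rewrite bounded_l2_0//; apply/funext => j; rewrite addr0.
Qed.

Lemma resolvent_quadratic T eps z : bounded_l2 T ->
  (forall u, l2 u -> T (T u) = fun j => eps * T u j) ->
  z != 0 -> z != eps -> resolvent T z.
Proof.
move=> bT TT z0 ze; have d0 : eps - z != 0 by rewrite subr_eq0 eq_sym.
(* Solving (T - z)(a T + b) = 1 with T^2 = eps T gives - z b = 1 and a (eps - z) + b = 0. *)
exists (fun u j => (z * (eps - z))^-1 * T u j + - z^-1 * u j).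
split=> [|u u2]; first exact: bounded_l2_lincomb.
have Tu2 := bounded_l2_l2 bT u2.
split.
  have -> : (fun j => T u j - z * u j) = fun j => 1 * T u j + - z * u j.
    by apply/funext => j; ring.
  rewrite bounded_l2_lin// TT//; apply/funext => j.
  by field; rewrite z0 d0.
rewrite bounded_l2_lin// TT//; apply/funext => j.
by field; rewrite z0 d0.
Qed.

Lemma eigen_spectrum T z u : bounded_l2 T -> l2 u -> u <> (fun=> 0) ->
  T u = (fun j => z * u j) -> spectrum T z.
Proof.
move=> bT u2 u0 Tu [B [bB /(_ _ u2)[+ _]]].
have -> : (fun j => T u j - z * u j) = fun=> 0.
  by apply/funext => j; rewrite Tu subrr.
by rewrite bounded_l2_0// => /esym.
Qed.

(** Supported at one red point, it is fixed by [Kloc]; it also serves as an eigenvector when the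
    operator vanishes on l2. *)
Definition red_delta : int * int -> R[i] := fun j => (j == (1, 0))%:R.

Lemma l2_red_delta : l2 red_delta.
Proof.
rewrite /l2 /= /l2sq (esumID [set (1, 0)])/=; last by move=> j _; rewrite lee_fin sqr_ge0.
rewrite setTI esum_set1 ?lee_fin ?sqr_ge0// esum1 ?adde0 ?ltry// => j [_ /= /eqP j0].
by rewrite /red_delta (negbTE j0) normc0 expr0n.
Qed.

Lemma red_delta_neq0 : red_delta <> (fun=> 0).
Proof. by move=> /(congr1 (@^~ (1, 0))) /eqP; rewrite /red_delta eqxx oner_eq0. Qed.

(** The spectrum lies in {0, eps}, and eps is attained: a nonzero [T u] is an eigenvector for it,
    while if T vanishes on l2 then eps = 0 and any nonzero vector works. *)
Lemma spectral_radius_op_quadratic T eps : bounded_l2 T ->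
  (forall u, l2 u -> T (T u) = fun j => eps * T u j) ->
  eps = 0 \/ (exists2 u, l2 u & T u <> fun=> 0) ->
  spectral_radius_op T = (normc eps)%:E.
Proof.
move=> bT TT T0; apply: ereal_sup_normc => [z|].
  apply: contra_notP => /not_orP[/eqP z0 /eqP ze]; exact: resolvent_quadratic TT z0 ze.
have [[u u2 Tu0]|H] := pselect (exists2 u, l2 u & T u <> fun=> 0).
  exact: (eigen_spectrum bT (bounded_l2_l2 bT u2) Tu0 (TT u u2)).
have -> : eps = 0 by case: T0.
apply: (eigen_spectrum bT l2_red_delta red_delta_neq0).
apply: contrapT => D0; apply: H; exists red_delta; first exact: l2_red_delta.
by move=> E; apply: D0; rewrite E; apply/funext => j; rewrite mul0r.
Qed.

(** [eigenvalue] is about row vectors, and A A = eps A makes every nonzero row of A a left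
    eigenvector for eps. *)
Lemma spectral_radius_mx_quadratic n (A : 'M[R[i]]_n.+1) eps : A *m A = eps *: A ->
  eps = 0 \/ A != 0 -> spectral_radius_mx A = (normc eps)%:E.
Proof.
move=> AA A0; apply: ereal_sup_normc => [z /= /eigenvalueP[v vA v0]|/=].
  have : (z * (z - eps)) *: v == 0.
    have : v *m (A *m A) = v *m (eps *: A) by rewrite AA.
    rewrite mulmxA -scalemxAr vA -scalemxAl vA !scalerA => e.
    by rewrite mulrBr scalerBl e mulrC subrr.
  by rewrite scaler_eq0 (negbTE v0) orbF mulf_eq0 subr_eq0 => /orP[/eqP|/eqP]; [left|right].
have [An0|An0] := eqVneq A 0; last first.
  have [i Ai] : exists i, row i A != 0.
    apply/existsP; apply: contraNT An0; rewrite negb_exists => /forallP H.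
    by apply/eqP/row_matrixP => i; rewrite row0; apply/eqP; rewrite -[_ == _]negbK.
  apply/eigenvalueP; exists (row i A) => //.
  by rewrite -row_mul AA; apply/rowP => k; rewrite !mxE.
have -> : eps = 0 by case: A0 => // /eqP.
apply/eigenvalueP; exists (const_mx 1); first by rewrite An0 mulmx0 scale0r.
by apply/eqP => /matrixP/(_ 0 0); rewrite !mxE => /eqP; rewrite oner_eq0.
Qed.
End Spectra.

(** * Both spectral radii of the cycle *)

Section TwoLevel.
Variables (R : realType) (h : R) (nu1 nu2 : nat).
Hypothesis h0 : 0 < h.

(* [Gloc] is nilpotent as soon as one smoothing step is performed, since a
   relaxation of the red points annihilates the range of [Kloc]. *)
Definition cycle_eps : R[i] := (nu1 + nu2 == 0)%N%:R.

Lemma Gloc_quadratic (u : int * int -> R[i]) :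
  Gloc h nu1 nu2 (Gloc h nu1 nu2 u) = fun j => cycle_eps * Gloc h nu1 nu2 u j.
Proof.
rewrite /cycle_eps; case: eqP => [/eqP|/eqP].
  rewrite addn_eq0 => /andP[/eqP -> /eqP ->]; rewrite /Gloc /= Kloc_idem.
  by apply/funext => j; rewrite mul1r.
rewrite -lt0n => nu0; rewrite Gloc_nilpotent//.
by apply/funext => j; rewrite mul0r.
Qed.

Lemma Kloc_red_delta : Kloc (@red_delta R) = @red_delta R.
Proof.
apply/funext => j; rewrite /Kloc.
have rb k : black k -> @red_delta R k = 0.
  by rewrite /red_delta; case: eqP => // ->.
case: ifP => bj; first by rewrite rb.
rewrite (@eq_nbsum _ _ (fun=> 0)) => [|k]; last by rewrite bj; exact: rb.
by rewrite /nbsum !addr0 mul0r subr0.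
Qed.

Lemma spectral_radius_Mop_l2 :
  spectral_radius_op (Mop_l2 h nu1 nu2) = (normc cycle_eps)%:E.
Proof.
have bM := bounded_Mop_l2 nu1 nu2 h0.
apply: (spectral_radius_op_quadratic bM) => [u u2|].
  have Mu2 := bounded_l2_l2 bM u2.
  by rewrite (Mop_l2_Gloc _ _ h0 Mu2) (Mop_l2_Gloc _ _ h0 u2) Gloc_quadratic.
rewrite /cycle_eps; case: eqP => [/eqP nu0|_]; [right|by left].
exists (@red_delta R); first exact: l2_red_delta.
rewrite (Mop_l2_Gloc _ _ h0 (@l2_red_delta R)).
move: nu0; rewrite addn_eq0 => /andP[/eqP -> /eqP ->].
by rewrite /Gloc /= Kloc_red_delta; exact: red_delta_neq0.
Qed.

Lemma spectral_radius_Mmx t : low_nz t ->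
  spectral_radius_mx (Mmx h nu1 nu2 t) = (normc cycle_eps)%:E.
Proof.
move=> tl; apply: spectral_radius_mx_quadratic.
  have comb_lin a (c d : 'cV[R[i]]_2) :
      comb h t (a *: c - d) = fun j => a * comb h t c j - comb h t d j.
    by apply/funext => j; rewrite /comb !mxE; ring.
  (* The relation is pulled back from [Gloc] through the injective map [comb], so that the powers of
     [Smx] stay unexpanded. *)
  have MM (c : 'cV[R[i]]_2) :
      Mmx h nu1 nu2 t *m (Mmx h nu1 nu2 t *m c) = cycle_eps *: (Mmx h nu1 nu2 t *m c).
    have e : comb h t (cycle_eps *: (Mmx h nu1 nu2 t *m c)
        - Mmx h nu1 nu2 t *m (Mmx h nu1 nu2 t *m c)) = (fun=> 0).
      rewrite comb_lin -!(Gloc_comb h0 _ _ _ tl) Gloc_quadratic.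
      by apply/funext => j; rewrite subrr.
    by have /eqP := comb_inj h0 e; rewrite subr_eq0 => /eqP.
  apply/matrixP => i j; have := congr1 (fun v : 'cV[R[i]]_2 => v i 0) (MM (delta_mx j 0)).
  by rewrite /= mulmxA scalemxAl -!colE [LHS]mxE [RHS]mxE.
rewrite /cycle_eps; case: eqP => [/eqP nu0|_]; [right|by left].
move: nu0; rewrite addn_eq0 => /andP[/eqP -> /eqP ->].
rewrite /Mmx !expr0 mul1mx mulmx1; apply/eqP => K0.
have [x0 _] := xi_neq tl.
have [+ _] := Kmx_mul h0 (delta_mx 0 0) tl.
rewrite K0 mul0mx !mxE /= mulr1 mulr0 subr0 => /eqP.
by rewrite eq_sym (inj_eq (@complexI R) _ 0) (negbTE x0).
Qed.
End TwoLevel.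

Theorem theorem4 (R : realType) (h : R) (hpos : 0 < h) (nu1 nu2 : nat) :
  (forall theta : R * R, low_nz theta ->
     [/\ (forall c : 'cV[R[i]]_2, comb h theta c = (fun=> 0) -> c = 0),
         (forall u, E h theta u -> E h theta (Mop h nu1 nu2 u)),
         has_matrix h theta (Mop h nu1 nu2) (Mmx h nu1 nu2 theta),
         LHhat h theta = (8 / h ^+ 2 * (xi theta * (1 - xi theta)))%:C &
         LHhat h theta != 0 /\
         forall b, LH h (inject (mode h theta)) b
                   = LHhat h theta * inject (mode h theta) b]) /\
  bounded_l2 (Mop_l2 h nu1 nu2) /\
  spectral_radius_op (Mop_l2 h nu1 nu2)
    = ereal_sup [set spectral_radius_mx (Mmx h nu1 nu2 theta) | theta in low_nz].
Proof.
split=> [theta tl|].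
  split; first exact: comb_inj.
  - move=> _ [c _ <-]; exists (Mmx h nu1 nu2 theta *m c) => //.
    by rewrite -Mop_comb.
  - exact: Mop_comb.
  - exact: LHhatE.
  - split; last by move=> b; exact: LH_eigen.
    by rewrite (LHhat_lamH hpos); exact: lamH_neq0.
split; first exact: bounded_Mop_l2.
rewrite spectral_radius_Mop_l2//.
(* The radius is the same at all frequencies; a point of [low_nz] ensures that the supremum is over
   a singleton and not over the empty set, where it would be -oo. *)
have low1 : low_nz (pi / 2, 0 : R).
  have p0 := pi_gt0 R; split; last by move=> [] /eqP; rewrite gt_eqF// divr_gt0.
  by split => /=; apply/andP; split; apply/andP; split => /=; lra.
suff -> : [set spectral_radius_mx (Mmx h nu1 nu2 theta) | theta in low_nz] =
    [set (normc (cycle_eps R nu1 nu2))%:E] by rewrite ereal_sup1.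
apply/seteqP; split => [_ [theta tl <-]|_ ->]; first exact: spectral_radius_Mmx.
by exists (pi / 2, 0) => //; exact: spectral_radius_Mmx.
Qed.
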